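(* Let $T$ be a $\lambda$-HST with $n$ leaves and height $H$ satisfying $H\le \lambda/10$, and let $\delta'=1/n^2$. There is an online fractional algorithm for the $k$-server problem on $T$ such that, for every request $(\ell_q,q)$, the request leaf $\ell_q$ has server mass more than $1-\delta'$ at some timestep in $[q,q+1)$, and whose total cost of (fractional) server movement is $O(H^2\log(n\lambda))$ times the cost of an optimal solution.
   Context: A $\lambda$-HST of height $H$ is a rooted tree in which the level of a node is its combinatorial height (leaves at level $0$, root at level $H$) and the edge from a non-root node $v$ to its parent has length $\lambda^{\mathrm{level}(v)}$; the metric is the shortest-path metric on the leaves. In the $k$-server problem on $T$, requests $(\ell_q,q)$ arrive online at distinct increasing integer times $q$ at leaves $\ell_q$, and an (integral) solution must have one of its $k$ servers at $\ell_q$ at time $q$; cost is total distance moved. Between consecutive request times $q$ and $q+1$ the fractional algorithm acts at discrete timesteps $q+i\eta$ for a small $\eta\in(0,1)$. A fractional algorithm maintains a nonnegative amount of server mass at each leaf and pays, for moving mass, the amount moved times the distance moved. *)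

(* Defs.v *)
From HB Require Import structures.
From mathcomp Require Import all_boot all_order all_algebra.
From mathcomp Require Import classical_sets reals exp.

Set Implicit Arguments.
Unset Strict Implicit.
Unset Printing Implicit Defensive.
Import Order.TTheory GRing.Theory Num.Theory.
Local Open Scope ring_scope.

(* The last field makes the tree connected and acyclic, and [root] the only
   node without a parent. *)
Record rooted_tree := RootedTree {
  node : finType;
  parent : node -> option node;
  root : node;
  parent_root : parent root = None;
  root_above : forall v : node,
    exists m : nat, iter m (obind parent) (Some v) = Some root
}.

Definition is_leaf (T : rooted_tree) (v : node T) : bool :=
  [forall u : node T, parent u != Some v].

Definition leaf (T : rooted_tree) : finType := {v : node T | is_leaf v}.

(* Combinatorial height: the largest number of edges on a downward path from
   [v] to a leaf; such a path has fewer than #|node T| edges. *)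
Definition level (T : rooted_tree) (v : node T) : nat :=
  \max_(m < #|node T| | [exists u : node T,
      is_leaf u && (iter m (obind (@parent T)) (Some u) == Some v)]) m.

Definition height (T : rooted_tree) : nat := level (root T).

Definition adjacent (T : rooted_tree) : rel (node T) :=
  fun u v => (parent u == Some v) || (parent v == Some u).

(* Only meaningful for adjacent [u] and [v]. *)
Definition edge_length (R : realType) (T : rooted_tree) (lambda : R)
    (u v : node T) : R :=
  if parent u == Some v then lambda ^+ level u else lambda ^+ level v.

Definition walk_length (R : realType) (T : rooted_tree) (lambda : R)
    (x : node T) (p : seq (node T)) : R :=
  \sum_(e <- zip (x :: p) p) edge_length lambda e.1 e.2.

Definition hst_dist (R : realType) (T : rooted_tree) (lambda : R)
    (x y : leaf T) : R :=
  inf [set c : R | exists2 p : seq (node T),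
        path (@adjacent T) (val x) p && (last (val x) p == val y)
        & c = walk_length lambda (val x) p].

(* A request is a leaf together with its arrival time. *)
Definition request (T : rooted_tree) : Type := (leaf T * int)%type.

Definition increasing_times (T : rooted_tree) (s : seq (request T)) : Prop :=
  sorted (fun a b : int => a < b) [seq r.2 | r <- s].

Section Integral.
Variables (R : realType) (T : rooted_tree) (lambda : R) (k : nat).

(* [S 0] is the initial configuration and [S j.+1] the configuration at the
   time of the request of index [j]. *)
Definition feasible (s0 : 'I_k -> leaf T) (s : seq (request T))
    (S : nat -> 'I_k -> leaf T) : Prop :=
  S 0%N = s0 /\
  forall (j : nat) (r : request T), onth s j = Some r ->
    exists i : 'I_k, S j.+1 i = r.1.

Definition solution_cost (s : seq (request T))
    (S : nat -> 'I_k -> leaf T) : R :=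
  \sum_(j < size s) \sum_(i < k) hst_dist lambda (S j i) (S j.+1 i).

Definition opt_cost (s0 : 'I_k -> leaf T) (s : seq (request T)) : R :=
  inf [set c : R | exists2 S : nat -> 'I_k -> leaf T,
        feasible s0 s S & c = solution_cost s S].

End Integral.

Section Fractional.
Variables (R : realType) (T : rooted_tree).

Definition config : Type := leaf T -> R.

(* [f u v] is the amount of mass moved from [u] to [v]. *)
Definition moves : Type := leaf T -> leaf T -> R.

Definition apply_moves (x : config) (f : moves) : config :=
  fun v => x v - \sum_(u : leaf T) f v u + \sum_(u : leaf T) f u v.

Definition valid_moves (x : config) (f : moves) : Prop :=
  (forall u v : leaf T, 0 <= f u v) /\
  (forall u : leaf T, \sum_(v : leaf T) f u v <= x u).

Definition moves_cost (lambda : R) (f : moves) : R :=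
  \sum_(u : leaf T) \sum_(v : leaf T) f u v * hst_dist lambda u v.

Definition initial_mass (k : nat) (s0 : 'I_k -> leaf T) : config :=
  fun v => #|[set i : 'I_k | s0 i == v]|%:R.

(* [A h i] is what the algorithm does at time q + i * eta when [h] is the
   sequence of all the requests that arrived so far, the last one at time q.
   Being a function of [h], it ignores the future. *)
Definition online_algorithm : Type := seq (request T) -> nat -> moves.

(* The number of timesteps q + i * eta in [q, q + 1), see [nstepsP]. *)
Definition nsteps (eta : R) : nat := `|Num.ceil eta^-1|%N.

Lemma nstepsP (eta : R) (i : nat) :
  0 < eta -> (i < nsteps eta)%N = (i%:R * eta < 1).
Proof.
move=> eta0; have e1 : 0 < eta^-1 by rewrite invr_gt0.
rewrite -ltr_pdivlMr // div1r -[i%:R]/(i%:~R) -ceil_gt_int /nsteps.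
rewrite -[in RHS](@gez0_abs (Num.ceil eta^-1)) ?ltz_nat //.
by rewrite ltW // ceil_gt0.
Qed.

Variables (eta : R) (x0 : config) (A : online_algorithm).

Definition after_steps (h : seq (request T)) (x : config) (i : nat) : config :=
  foldl apply_moves x [seq A h i' | i' <- iota 0 i].

(* The configuration just before the arrival of the request of index [j]. *)
Fixpoint start_config (s : seq (request T)) (j : nat) : config :=
  if j is j'.+1 then
    after_steps (take j s) (start_config s j') (nsteps eta)
  else x0.

(* The mass at time q + i * eta, once the algorithm has acted at that time,
   where q is the arrival time of the request of index [j]. *)
Definition mass_at (s : seq (request T)) (j i : nat) : config :=
  after_steps (take j.+1 s) (start_config s j) i.+1.

Definition valid_run (s : seq (request T)) : Prop :=
  forall j i : nat, (j < size s)%N -> (i < nsteps eta)%N ->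
    valid_moves (after_steps (take j.+1 s) (start_config s j) i)
                (A (take j.+1 s) i).

Definition serves (delta : R) (s : seq (request T)) : Prop :=
  forall (j : nat) (r : request T), onth s j = Some r ->
    exists2 i : nat, (i < nsteps eta)%N & 1 - delta < mass_at s j i r.1.

Definition run_cost (lambda : R) (s : seq (request T)) : R :=
  \sum_(j < size s) \sum_(i < nsteps eta) moves_cost lambda (A (take j.+1 s) i).

End Fractional.

(* Main.v *)
Require Import Defs.
From HB Require Import structures.
From mathcomp Require Import all_boot all_order all_algebra.
From mathcomp Require Import classical_sets reals exp.
From mathcomp Require Import boolp topology normedtype derive.
From mathcomp Require Import zify ring lra.

Set Implicit Arguments.
Unset Strict Implicit.
Unset Printing Implicit Defensive.
Import Order.TTheory GRing.Theory Num.Theory.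
Import numFieldNormedType.Exports.
Local Open Scope ring_scope.

(* A fractional state is a point [x] of the assignment polytope of the tree,
   where [x (u, i)] is the missing fraction of the i-th server below the node
   [u]. A request at the leaf [l] projects [x] onto the part of the polytope
   where [x (l, 0) <= d], for the divergence [D] that sums the weighted
   Kullback-Leibler terms of the coordinates shifted by [d].

   If [y] is the integral state of an optimal solution, which satisfies the
   request, the projection [x'] of [x] satisfies
     [D y x - D y x' = D x' x + Q], with [Q >= 0]
   by the variational inequality. Testing the variational inequality with the
   direction that raises [x' + d] on the whole subtree strictly below a node
   [u], and at [u] on the decreased coordinates only, bounds the decrease at
   [u] by [2 Q] if [u] is above [l], plus the net increase strictly below [u].
   Summing over [u], each step moves at most [4 H (D y x - D y x')], [H] being
   the height, up to a weighted sum of coordinate increments, which telescopes.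
   A unit of optimal movement changes [D] by at most [ln ((1 + d) / d)], and
   the telescoped sum is controlled by the final divergence, up to an error of
   order [H] when [d] is about [1 / (n^3 lambda^H)]. This error is absorbed by
   the optimal cost, which is at least 1 as soon as the state moves at all. *)

(** * Trees *)

Section Tree.
Variable T : rooted_tree.
Local Open Scope nat_scope.
Implicit Types (u v a b p : node T) (i j m : nat).

Definition up m v : option (node T) := iter m (obind (@parent T)) (Some v).

Lemma upS m v : up m.+1 v = obind (@parent T) (up m v).
Proof. by []. Qed.

Lemma upSr m v p : parent v = Some p -> up m.+1 v = up m p.
Proof. by move=> vp; rewrite /up iterSr /= vp. Qed.

Lemma up_add i j v b : up i v = Some b -> up (j + i) v = up j b.
Proof. by rewrite /up iterD => ->. Qed.

Lemma up_root m : 0 < m -> up m (Defs.root T) = None.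
Proof.
case: m => // m _; rewrite /up iterSr /= parent_root.
by elim: m => //= m ->.
Qed.

Lemma up_root_inj i j v :
  up i v = Some (Defs.root T) -> up j v = Some (Defs.root T) -> i = j.
Proof.
wlog ij : i j / i <= j.
  by move=> W ui uj; case: (leqP i j) => [|/ltnW] ij; [|apply/esym]; exact: W.
move=> ui; rewrite -(subnK ij) (up_add _ ui) => uj.
case: (posnP (j - i)) => [->//|j0].
by rewrite (up_root j0) in uj.
Qed.

Lemma up_to_root v : exists m, up m v == Some (Defs.root T).
Proof. by have [m um] := root_above v; exists m; apply/eqP. Qed.

Definition depth v : nat := ex_minn (up_to_root v).

Lemma depthP v : up (depth v) v = Some (Defs.root T).
Proof. by rewrite /depth; case: ex_minnP => m /eqP. Qed.

Lemma depth_up m v b : up m v = Some b -> depth v = depth b + m.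
Proof.
move=> vb; apply: (@up_root_inj _ _ v); first exact: depthP.
by rewrite (up_add _ vb) depthP.
Qed.

Definition is_child a b := parent a == Some b.

Definition below : rel (node T) := connect is_child.

Lemma belowP a b : reflect (exists m, up m a = Some b) (below a b).
Proof.
apply: (iffP idP) => [/connectP[p]|[m]].
  elim: p a => [a _ ->|c p IH a /= /andP[/eqP ac pc] e]; first by exists 0.
  by have [m um] := IH _ pc e; exists m.+1; rewrite (upSr _ ac).
elim: m b => [b [->]|m IH b]; first exact: connect0.
rewrite upS; case E: (up m a) => [c|//] /= cb.
by apply: (connect_trans (IH _ E)); apply: connect1; apply/eqP.
Qed.

Lemma below_refl a : below a a. Proof. exact: connect0. Qed.

Lemma below_trans : transitive below. Proof. exact: connect_trans. Qed.

Lemma below_parent a p : parent a = Some p -> below a p.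
Proof. by move=> ap; apply: connect1; apply/eqP. Qed.

Lemma below_root a : below a (Defs.root T).
Proof. by apply/belowP; exists (depth a); exact: depthP. Qed.

Lemma below_depth a b : below a b -> a != b -> depth b < depth a.
Proof.
move=> /belowP[[|m] ab]; first by case: ab => ->; rewrite eqxx.
by move=> _; rewrite (depth_up ab) addnS ltnS leq_addr.
Qed.

Lemma below_anti a b : below a b -> below b a -> a = b.
Proof.
move=> ab ba; apply: contraTeq isT => n.
have := ltn_trans (below_depth ab n) (below_depth ba _).
by rewrite ltnn eq_sym => /(_ n).
Qed.

Lemma below_total a u v : below a u -> below a v -> below u v || below v u.
Proof.
move=> /belowP[i ui] /belowP[j vj].
wlog ij : i j u v ui vj / i <= j.
  move=> W; case: (leqP i j) => [|/ltnW] ij; first exact: (W i j).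
  by rewrite orbC; exact: (W j i).
apply/orP; left; apply/belowP; exists (j - i).
by rewrite -(up_add _ ui) subnK.
Qed.

Lemma below_step a p u : parent a = Some p ->
  below a u = (u == a) || below p u.
Proof.
move=> ap; apply/idP/orP => [/belowP[[|m]]|[/eqP->|pu]].
- by case=> ->; left.
- by rewrite (upSr _ ap) => pu; right; apply/belowP; exists m.
- exact: below_refl.
- exact: below_trans (below_parent ap) pu.
Qed.

Lemma parent_not_below a p : parent a = Some p -> ~~ below p a.
Proof.
move=> ap; apply/negP => pa.
have e : a = p := below_anti (below_parent ap) pa.
have := @depth_up 1 a p; rewrite /up /= ap => /(_ erefl).
by rewrite e addn1 => /n_Sn.
Qed.

Lemma parent_exists a : a != Defs.root T -> exists p, parent a = Some p.
Proof.
move=> ar; have := depthP a; case E: (parent a) => [p|]; first by exists p.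
case: (depth a) => [|m]; first by case=> e; rewrite e eqxx in ar.
have N : iter m (obind (@parent T)) None = None by elim: m => //= m ->.
by rewrite /up iterSr /= E N.
Qed.

Lemma child_neq_root a p : parent a = Some p -> a != Defs.root T.
Proof. by apply: contra_eq_neq => ->; rewrite parent_root. Qed.

Lemma below_leaf a b : is_leaf b -> below a b -> a = b.
Proof.
move=> /forallP lb /belowP[[[]//|m]]; rewrite upS.
case E: (up m a) => [c|//] /= cb.
by have := lb c; rewrite cb eqxx.
Qed.

Lemma nonleaf_child p : ~~ is_leaf p -> exists u, parent u = Some p.
Proof.
by rewrite negb_forall => /existsP[u]; rewrite negbK => /eqP; exists u.
Qed.

(** The ancestors of [a] have pairwise distinct depths. This makes the bounded range of [m] in
    [level] harmless. *)
Lemma depth_card a : depth a < #|node T|.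
Proof.
pose f (i : 'I_(depth a).+1) := odflt a (up i a).
have fE (i : 'I_(depth a).+1) : up i a = Some (f i).
  rewrite /f; case E: (up i a) => [//|] /=.
  have := depthP a; have /subnK <- : i <= depth a by rewrite -ltnS.
  have N m : iter m (obind (@parent T)) None = None by elim: m => //= m ->.
  by rewrite /up iterD -/(up i a) E N.
suff fI : injective f.
  by have := leq_card f fI; rewrite card_ord.
move=> i j fij; apply: val_inj => /=.
have ei := depth_up (fE i); have ej := depth_up (fE j); rewrite fij in ei.
exact: addnI (etrans (esym ei) ej).
Qed.

Lemma leaf_below a : exists l : leaf T, below (val l) a.
Proof.
case: (@arg_maxnP _ a (fun v => below v a) depth (below_refl a)) => v va vmax.
suff lv : is_leaf v by exists (Sub v lv).
apply: contraT => /nonleaf_child[u uv].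
have := vmax u (below_trans (below_parent uv) va).
have := @depth_up 1 u v; rewrite /up /= uv => /(_ erefl) ->.
by rewrite addn1 ltnn.
Qed.

Lemma up_level j v u : is_leaf u -> up j u = Some v -> j <= level v.
Proof.
move=> lu uv; have jn : j < #|node T|.
  by apply: leq_ltn_trans (depth_card u); rewrite (depth_up uv) leq_addl.
apply: (@leq_bigmax_cond _ _ (fun i : 'I_#|node T| => nat_of_ord i)
  (Ordinal jn)).
by apply/existsP; exists u; rewrite lu /=; apply/eqP.
Qed.

Lemma level_attained v : exists2 u, is_leaf u & up (level v) u = Some v.
Proof.
have [[u lu] /= /belowP[m um]] := leaf_below v.
have mn : m < #|node T|.
  by apply: leq_ltn_trans (depth_card u); rewrite (depth_up um) leq_addl.
pose P (i : 'I_#|node T|) := [exists u : node T,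
      is_leaf u && (iter i (obind (@parent T)) (Some u) == Some v)].
have Pm : P (Ordinal mn) by apply/existsP; exists u; rewrite lu; apply/eqP.
have : 0 < #|P| by apply/card_gt0P; exists (Ordinal mn).
move=> /(eq_bigmax_cond (fun i : 'I_#|node T| => nat_of_ord i))[i].
rewrite unfold_in /P => /existsP[w /andP[lw /eqP wi]] e.
by exists w => //; rewrite /level; rewrite /P in e; rewrite e.
Qed.

Lemma level_parent u p : parent u = Some p -> level u < level p.
Proof.
move=> up_; have [w lw wu] := level_attained u.
by apply: (up_level lw); rewrite upS wu.
Qed.

Lemma level_below a b : below a b -> a != b -> level a < level b.
Proof.
move=> /belowP[m]; elim: m a => [a [->]|m IH a]; first by rewrite eqxx.
case: (eqVneq a (Defs.root T)) => [-> |/parent_exists[p ap]].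
  by rewrite up_root.
rewrite (upSr _ ap) => /IH {}IH _.
case: (eqVneq p b) => [<-|/IH]; first exact: level_parent.
exact: ltn_trans (level_parent ap).
Qed.

Lemma level_lt_height u : u != Defs.root T -> level u < height T.
Proof. exact: level_below (below_root u). Qed.

(** [v] counts among its own ancestors. A sum over [u] is the form that arises when [raise_bound] is
    summed over [u]. *)
Definition nranc v : nat := \sum_(u | (u != Defs.root T) && below v u) 1.

(* Ancestors of a node have distinct levels. *)
Lemma nranc_height v : nranc v <= height T.
Proof.
rewrite /nranc sum1_card cardE -(size_map (@level T)).
rewrite -[leqRHS](size_iota 0); apply: uniq_leq_size; last first.
  move=> i /mapP[u]; rewrite mem_enum => /andP[ur _] ->.
  by rewrite mem_iota add0n level_lt_height.
rewrite map_inj_in_uniq ?enum_uniq // => a b.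
rewrite !mem_enum !unfold_in => /andP[ar va] /andP[br vb].
move=> e; apply: contra_eq e => ab.
case/orP: (below_total va vb) => /level_below.
  by move=> /(_ ab); rewrite neq_ltn => ->.
by rewrite eq_sym => /(_ ab); rewrite neq_ltn orbC => ->.
Qed.

End Tree.

(** * The tree metric *)

Section Separation.
Variables (R : realType) (T : rooted_tree) (lambda : R).
Hypothesis lambda_ge2 : 2 <= lambda.
Implicit Types (u v a b p : node T).

(** The weight of [v] is the length of the edge above it; the root has no such edge. *)
Definition wt v : R := if v == Defs.root T then 0 else lambda ^+ level v.

(** The tree metric as a sum of cut metrics: the edge above [u] lies between [a] and [b] iff exactly
    one of them is below [u]. *)
Definition sep a b : R := \sum_u wt u * (below a u != below b u)%:R.

Let lambda_ge1 : 1 <= lambda. Proof. by apply: le_trans lambda_ge2; lra. Qed.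
Let lambda_ge0 : 0 <= lambda. Proof. by apply: le_trans lambda_ge2; lra. Qed.

Lemma wt_ge0 v : 0 <= wt v.
Proof. by rewrite /wt; case: eqP => // _; rewrite exprn_ge0. Qed.

Lemma wt_ge1 v : v != Defs.root T -> 1 <= wt v.
Proof. by rewrite /wt => /negPf ->; rewrite exprn_ege1. Qed.

Lemma sep_ge0 a b : 0 <= sep a b.
Proof. by apply: sumr_ge0 => u _; rewrite mulr_ge0 ?wt_ge0 // ler0n. Qed.

Lemma sepxx a : sep a a = 0.
Proof. by apply: big1 => u _; rewrite eqxx mulr0. Qed.

Lemma sepC a b : sep a b = sep b a.
Proof. by apply: eq_bigr => u _; rewrite eq_sym. Qed.

Lemma sep_triangle a b p : sep a b <= sep a p + sep p b.
Proof.
rewrite -big_split; apply: ler_sum => u _ /=.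
rewrite -mulrDr ler_wpM2l ?wt_ge0 // -natrD ler_nat.
by case: (below a u); case: (below b u); case: (below p u).
Qed.

Lemma sep_step a p b :
  parent a = Some p -> ~~ below b a -> sep a b = wt a + sep p b.
Proof.
move=> ap ba; rewrite /sep (bigD1 a) //= [in RHS](bigD1 a) //= below_refl.
rewrite (negPf ba) (negPf (parent_not_below ap)) /= mulr1 mulr0 add0r.
congr (_ + _); apply: eq_bigr => u ua.
by rewrite (below_step _ ap) (negPf ua).
Qed.

Lemma sep_parent a p : parent a = Some p -> sep a p = wt a.
Proof.
by move=> ap; rewrite (sep_step ap (parent_not_below ap)) sepxx addr0.
Qed.

Lemma edge_length_parent a p : parent a = Some p ->
  edge_length lambda a p = wt a.
Proof.
by move=> ap; rewrite /edge_length /wt ap eqxx (negPf (child_neq_root ap)).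
Qed.

Lemma edge_length_child a p : parent a = Some p ->
  edge_length lambda p a = wt a.
Proof.
move=> ap; rewrite /edge_length /wt (negPf (child_neq_root ap)).
case: eqP => // pa; have := parent_not_below ap.
by rewrite (below_parent pa).
Qed.

Lemma walk_length_cons a b (s : seq (node T)) :
  walk_length lambda a (b :: s) = edge_length lambda a b + walk_length lambda b s.
Proof. by rewrite /walk_length /= big_cons. Qed.

Lemma walk_length_rcons a b (s : seq (node T)) :
  walk_length lambda a (rcons s b) =
    walk_length lambda a s + edge_length lambda (last a s) b.
Proof.
elim: s a => [|c s IH] a /=.
  by rewrite walk_length_cons /walk_length /= !big_nil add0r addr0.
by rewrite !walk_length_cons IH addrA.
Qed.

Lemma sep_le_walk a (s : seq (node T)) :
  path (@adjacent T) a s -> sep a (last a s) <= walk_length lambda a s.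
Proof.
elim: s a => [|b s IH] a /=; first by rewrite sepxx /walk_length big_nil.
move=> /andP[ab bs]; rewrite walk_length_cons.
apply: le_trans (sep_triangle _ _ b) (lerD _ (IH _ bs)).
case/orP: ab => /eqP ab; first by rewrite edge_length_parent // sep_parent.
by rewrite edge_length_child // sepC sep_parent.
Qed.

(** Induction on the sum of the depths: an endpoint that is not an ancestor of the other one is
    replaced by its parent, at the cost of one edge that separates the two. *)
Lemma walk_exists a b : exists2 s : seq (node T),
  path (@adjacent T) a s && (last a s == b) & walk_length lambda a s = sep a b.
Proof.
have [n] := ubnP (depth a + depth b)%N; elim: n a b => // n IH a b.
have depth_parent (c q : node T) : parent c = Some q -> depth c = (depth q).+1.
  by move=> cq; rewrite (@depth_up _ 1 c q) ?addn1 // /up /= cq.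
case: (boolP (below b a)) => [ba|nba].
  case: (eqVneq a b) => [->|ab] ltn.
    by exists [::]; rewrite /= ?eqxx // sepxx /walk_length big_nil.
  have nab : ~~ below a b by apply: contra ab => /(below_anti ba) ->.
  have /parent_exists[q bq] : b != Defs.root T.
    by apply: contra nab => /eqP ->; exact: below_root.
  have [|s /andP[ps /eqP ls] ws] := IH a q.
    by rewrite (depth_parent b q bq) in ltn; lia.
  exists (rcons s b); rewrite ?rcons_path ?last_rcons ?ps ?ls ?eqxx ?andbT /=.
    by rewrite /adjacent bq eqxx orbT.
  rewrite walk_length_rcons ls ws edge_length_child //.
  by rewrite [RHS]sepC (sep_step bq nab) addrC sepC.
move=> ltn; have /parent_exists[q aq] : a != Defs.root T.
  by apply: contra nba => /eqP ->; exact: below_root.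
have [|s /andP[ps ls] ws] := IH q b.
  by rewrite (depth_parent a q aq) in ltn; lia.
exists (q :: s); first by rewrite /= ps ls /adjacent aq eqxx.
by rewrite walk_length_cons ws edge_length_parent // (sep_step aq nba).
Qed.

Lemma hst_distE (x y : leaf T) : hst_dist lambda x y = sep (val x) (val y).
Proof.
rewrite /hst_dist; set A := (X in inf X).
have lbA : lbound A (sep (val x) (val y)).
  by move=> c [s /andP[ps /eqP ls] ->]; rewrite -ls; exact: sep_le_walk.
have [s ps ws] := walk_exists (val x) (val y).
have As : A (sep (val x) (val y)) by exists s.
apply/le_anti/andP; split; first by apply: ge_inf => //; exists (sep (val x) (val y)).
by apply: lb_le_inf => //; exists (sep (val x) (val y)).
Qed.

(** The edge to a child [u] and the remaining descent are each at most [lambda ^+ level u], and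
    [2 <= lambda] absorbs the factor 2 into the next level. *)
Lemma near_leaf v : exists l : leaf T, sep v (val l) <= lambda ^+ level v.
Proof.
have [n] := ubnP (level v); elim: n v => // n IH v ltn.
case: (boolP (is_leaf v)) => [lv|/nonleaf_child[u uv]].
  by exists (Sub v lv); rewrite /= sepxx exprn_ge0.
have lt := level_parent uv.
have [|l ul] := IH u; first by lia.
exists l; apply: le_trans (sep_triangle _ _ u) _.
rewrite sepC (sep_parent uv) /wt (negPf (child_neq_root uv)).
apply: (le_trans (y := lambda ^+ (level u).+1)); last exact: ler_weXn2l.
have := exprn_ge0 (level u) lambda_ge0.
by rewrite exprS; move: ul lambda_ge2; nra.
Qed.

(* An anchor of [v] is a leaf nearest to [v]; idle mass of [v] is kept there. *)
Lemma anchor_exists : exists phi : node T -> leaf T,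
  (forall l : leaf T, phi (val l) = l) /\
  (forall s p, parent s = Some p -> sep (val (phi s)) (val (phi p)) <= 4 * wt s).
Proof.
have [l0 _] := leaf_below (Defs.root T).
(* A leaf is its own anchor by definition, without an appeal to uniqueness of the minimizer. *)
pose phi v : leaf T := if insub v is Some l then l
  else [arg min_(l < l0) sep v (val l)]%O.
have phi_min v (l : leaf T) : sep v (val (phi v)) <= sep v (val l).
  rewrite /phi; case: insubP => [l' _ <-|_]; first by rewrite sepxx sep_ge0.
  by case: arg_minP => // l' _ h; exact: (h l isT).
exists phi; split=> [l|s p sp]; first by rewrite /phi valK.
have [l sl] := near_leaf s.
have ws : wt s = lambda ^+ level s by rewrite /wt (negPf (child_neq_root sp)).
have ps : sep p s = wt s by rewrite sepC sep_parent.
(* The route [phi s], [s], [p], [phi p] has legs of at most 1, 1 and 2 times [wt s], which gives the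
   factor 4. *)
have h1 := le_trans (phi_min s l) sl.
have h2 := le_trans (phi_min p l) (sep_triangle p (val l) s).
have h3 := sep_triangle (val (phi s)) (val (phi p)) s.
have h4 := sep_triangle s (val (phi p)) p.
by rewrite [sep (val (phi s)) s]sepC [sep s p]sepC in h3 h4; lra.
Qed.

(** Greedy optimal transport on a tree, by induction on the number of leaves with [f] nonzero.
    Surplus is matched with deficit under a lowest node that has both below it, so no edge carries
    mass in both directions and each cut pays exactly its net imbalance. *)
Lemma transport (f : leaf T -> R) : \sum_l f l = 0 ->
  exists g : leaf T -> leaf T -> R, [/\ forall x y, 0 <= g x y,
    forall x, \sum_y g x y = Num.max (f x) 0,
    forall y, \sum_x g x y = Num.max (- f y) 0 &
    \sum_x \sum_y g x y * sep (val x) (val y) <=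
      \sum_u wt u * `|\sum_(l : leaf T | below (val l) u) f l|].
Proof.
have [n] := ubnP #|[set x | f x != 0]|; elim: n f => // n IH f ltn f0.
case: (pickP (fun x => f x != 0)) => [c fc|fz]; last first.
  have fE x : f x = 0 by apply/eqP/negPn; rewrite (fz x).
  exists (fun _ _ => 0); split=> // [a|b|].
  - by rewrite fE big1 ?maxxx.
  - by rewrite fE oppr0 big1 ?maxxx.
  - rewrite big1 => [|a _]; last by rewrite big1 // => b _; rewrite mul0r.
    by apply: sumr_ge0 => u _; rewrite mulr_ge0 ?wt_ge0.
pose pos u := [exists a : leaf T, below (val a) u && (0 < f a)].
pose neg u := [exists a : leaf T, below (val a) u && (f a < 0)].
have no_pos u : pos u = false -> forall a : leaf T, below (val a) u -> f a <= 0.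
  by move=> /existsPn h a au; have := h a; rewrite au /= -leNgt.
have no_neg u : neg u = false -> forall a : leaf T, below (val a) u -> 0 <= f a.
  by move=> /existsPn h a au; have := h a; rewrite au /= -leNgt.
have root_both : pos (Defs.root T) && neg (Defs.root T).
  apply: contraT => h; suff fz x : f x = 0 by rewrite fz eqxx in fc.
  have br (x : leaf T) := below_root (val x).
  move: h; rewrite negb_and => /orP[] /negPf h.
    have f1 y : 0 <= - f y by rewrite oppr_ge0 (no_pos _ h).
    apply/eqP; rewrite -oppr_eq0; apply/eqP.
    by apply: (psumr_eq0P (P := xpredT) (F := fun x => - f x)) => //;
       rewrite sumrN f0 oppr0.
  have f1 y : 0 <= f y by rewrite (no_neg _ h).
  exact: (psumr_eq0P (P := xpredT) (F := f)).
case: (@arg_minnP _ (Defs.root T) (fun u => pos u && neg u) (@level T)) => //.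
move=> u /andP[/existsP[a /andP[au fa]] /existsP[b /andP[bu fb]]] umin.
have ab : a != b by apply: contraTneq fa => ->; rewrite -leNgt ltW.
pose m := Num.min (f a) (- f b).
have m0 : 0 < m by rewrite /m lt_min fa oppr_gt0.
have ma : m <= f a by rewrite /m ge_min lexx.
have mb : m <= - f b by rewrite /m ge_min lexx orbT.
pose f1 l := f l - m * (l == a)%:R + m * (l == b)%:R.
have sum1 (P : pred (leaf T)) (x : leaf T) :
    \sum_(l | P l) m * (l == x)%:R = m * (P x)%:R.
  rewrite -mulr_sumr; congr (_ * _); rewrite -natr_sum; congr (_%:R).
  case: (boolP (P x)) => Px; last first.
    by rewrite big1 // => l Pl; case: eqP Pl Px => // -> ->.
  by rewrite (bigD1 x) //= eqxx big1 // => l /andP[_ /negPf ->].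
have sumf1 (P : pred (leaf T)) : \sum_(l | P l) f1 l =
    \sum_(l | P l) f l - m * (P a)%:R + m * (P b)%:R.
  by rewrite big_split sumrB !sum1.
have f1a : f1 a = f a - m by rewrite /f1 eqxx (negPf ab) mulr1 mulr0 addr0.
have f1b : f1 b = f b + m by rewrite /f1 eqxx eq_sym (negPf ab) mulr1 mulr0 subr0.
have f1l l : l != a -> l != b -> f1 l = f l.
  by rewrite /f1 => /negPf -> /negPf ->; rewrite mulr0 subr0 addr0.
have maxa : Num.max (f a) 0 = f a by apply/max_idPl/ltW.
have maxa1 : Num.max (f1 a) 0 = f1 a by apply/max_idPl; rewrite f1a subr_ge0.
have maxna : Num.max (- f a) 0 = 0 by apply/max_idPr; rewrite oppr_le0 ltW.
have maxna1 : Num.max (- f1 a) 0 = 0.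
  by apply/max_idPr; rewrite oppr_le0 f1a subr_ge0.
have maxb : Num.max (f b) 0 = 0 by apply/max_idPr/ltW.
have maxb1 : Num.max (f1 b) 0 = 0 by apply/max_idPr; rewrite f1b; lra.
have maxnb : Num.max (- f b) 0 = - f b.
  by apply/max_idPl; rewrite oppr_ge0 ltW.
have maxnb1 : Num.max (- f1 b) 0 = - f1 b by apply/max_idPl; rewrite f1b; lra.
have [||g [g0 grow gcol gcost]] := IH f1.
(* The leaf that attains the minimum in [m] leaves the support. *)
- rewrite -ltnS; apply: leq_trans ltn; rewrite ltnS; apply: proper_card.
  have sub : [set l | f1 l != 0] \subset [set l | f l != 0].
    apply/fintype.subsetP => l; rewrite !inE.
    case: (eqVneq l a) => [-> _|la]; first by rewrite gt_eqF.
    case: (eqVneq l b) => [-> _|lb]; first by rewrite lt_eqF.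
    by rewrite f1l.
  rewrite properE sub /=; apply/fintype.subsetPn.
  case: (leP (f a) (- f b)) => h.
    exists a; rewrite inE; first by rewrite gt_eqF.
    by rewrite negbK f1a /m (min_idPl h) subrr.
  exists b; rewrite inE; first by rewrite lt_eqF.
  by rewrite negbK f1b /m (min_idPr (ltW h)) subrr.
- by rewrite sumf1 f0 sub0r addNr.
have rowS (x : leaf T) : \sum_l m * ((x == a) && (l == b))%:R = m * (x == a)%:R.
  case: (x == a) => /=; last by rewrite big1 ?mulr0 // => l _; rewrite mulr0.
  by rewrite sum1 mulr1.
have colS (x : leaf T) : \sum_l m * ((l == a) && (x == b))%:R = m * (x == b)%:R.
  case: (x == b) => /=; last first.
    by rewrite big1 ?mulr0 // => l _; rewrite andbF mulr0.
  by rewrite (eq_bigr (fun l => m * (l == a)%:R)) ?sum1 // => l _; rewrite andbT.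
exists (fun x y => g x y + m * ((x == a) && (y == b))%:R); split.
- by move=> x y; rewrite addr_ge0 // mulr_ge0 ?ler0n // ltW.
- move=> x; rewrite big_split /= grow rowS.
  case: (eqVneq x a) => [->|xa].
    by rewrite maxa maxa1 f1a mulr1 subrK.
  rewrite mulr0 addr0; case: (eqVneq x b) => [->|xb]; last by rewrite f1l.
  by rewrite maxb maxb1.
- move=> y; rewrite big_split /= gcol colS.
  case: (eqVneq y b) => [->|yb].
    by rewrite maxnb maxnb1 f1b mulr1 opprD subrK.
  rewrite mulr0 addr0; case: (eqVneq y a) => [->|ya]; last by rewrite f1l.
  by rewrite maxna maxna1.
have cut v : `|\sum_(l : leaf T | below (val l) v) f l| =
    `|\sum_(l : leaf T | below (val l) v) f1 l| +
    m * (below (val a) v != below (val b) v)%:R.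
  rewrite (sumf1 (fun l : leaf T => below (val l) v)).
  (* A node that separates [a] from [b] is strictly below [u], so by minimality of [u] only one sign
     occurs below it. Moving [m] then lowers the imbalance there by exactly [m]. *)
  have sign_const : below (val a) v != below (val b) v ->
      ~~ (pos v && neg v).
    move=> sepv; apply/negP => pn; have := umin v pn.
    suff vu : below v u.
      have : v != u by apply: contra sepv => /eqP ->; rewrite au bu.
      by move=> /(level_below vu); rewrite ltnNge => /negbTE ->.
    case: (boolP (below (val a) v)) sepv => av.
      move=> bv; case/orP: (below_total au av) => // uv.
      by rewrite (below_trans bu uv) in bv.
    rewrite eq_sym eqbF_neg negbK => bv.
    case/orP: (below_total bu bv) => // uv.
    by rewrite (below_trans au uv) in av.
  case: (boolP (below (val a) v)) sign_const => av;
    case: (boolP (below (val b) v)) => bv; rewrite ?mulr1 ?mulr0 /=.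
  - by rewrite subrK addr0.
  - have -> : pos v by apply/existsP; exists a; rewrite av.
    move=> /(_ isT) /negPf h; set s := \sum_(_ | _) _.
    have sa : f a <= s.
      rewrite /s (bigD1 a) //= lerDl; apply: sumr_ge0 => l /andP[lv _].
      exact: no_neg lv.
    by rewrite addr0 !ger0_norm; lra.
  - have -> : neg v by apply/existsP; exists b; rewrite bv.
    rewrite andbT => /(_ isT) /negPf h; set s := \sum_(_ | _) _.
    have sb : s <= f b.
      rewrite /s (bigD1 b) //= gerDl; apply: sumr_le0 => l /andP[lv _].
      exact: no_pos lv.
    by rewrite subr0 !ler0_norm; lra.
  - by rewrite subr0 !addr0.
have cost1 : \sum_x \sum_y m * ((x == a) && (y == b))%:R *
    sep (val x) (val y) = m * sep (val a) (val b).
  rewrite (bigD1 a) //= (bigD1 b) //= !eqxx mulr1 !big1 ?addr0 //.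
    move=> x /negPf xa; rewrite big1 // => y _.
    by rewrite xa /= mulr0 mul0r.
  by move=> y /negPf ->; rewrite /= mulr0 mul0r.
have -> : \sum_x \sum_y (g x y + m * ((x == a) && (y == b))%:R) *
    sep (val x) (val y) =
    \sum_x \sum_y g x y * sep (val x) (val y) + m * sep (val a) (val b).
  rewrite -cost1 -big_split; apply: eq_bigr => x _ /=.
  by rewrite -big_split; apply: eq_bigr => y _ /=; rewrite mulrDl.
rewrite (le_trans (lerD gcost (lexx _))) // /sep mulr_sumr -big_split /=.
by apply: ler_sum => v _; rewrite cut; lra.
Qed.

Lemma sum_below (M : nmodType) (F : leaf T -> M) p : ~~ is_leaf p ->
  \sum_(l : leaf T | below (val l) p) F l =
  \sum_(u | parent u == Some p) \sum_(l : leaf T | below (val l) u) F l.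
Proof.
move=> np; rewrite (exchange_big_dep (fun l : leaf T => below (val l) p)) /=;
  last first.
  by move=> u l /eqP up_ lu; exact: below_trans lu (below_parent up_).
apply: eq_bigr => l lp; have /belowP[[[e]|m]] := lp.
  by rewrite -e (valP l) in np.
rewrite upS; case E: (up m (val l)) => [u|//] /= up_.
have lu : below (val l) u by apply/belowP; exists m.
rewrite (big_pred1 u) // => v /=; apply/andP/eqP => [[/eqP vp lv]|->]; last first.
  by rewrite up_ eqxx lu.
case/orP: (below_total lu lv).
  rewrite (below_step _ up_) => /orP[/eqP//|pv].
  by rewrite (negPf (parent_not_below vp)) in pv.
rewrite (below_step _ vp) => /orP[/eqP//|pu].
by rewrite (negPf (parent_not_below up_)) in pu.
Qed.

End Separation.

(** * Divergence and minimization *)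

Section Kl.
Variable R : realType.
Implicit Types a b c : R.

(** The Bregman divergence of [t * ln t]; the linear terms make it nonnegative without any
    normalization. *)
Definition kl a b : R := a * ln (a / b) - a + b.

Lemma ln_le_sub1 a : 0 < a -> ln a <= a - 1.
Proof.
move=> a0; have := @le_ln1Dx R (a - 1); rewrite addrCA subrr addr0; apply.
by rewrite ltrBrDl subrr.
Qed.

Lemma lnVN a : 0 < a -> ln a^-1 = - ln a.
Proof. by move=> a0; rewrite lnV. Qed.

Lemma kl_ge0 a b : 0 < a -> 0 < b -> 0 <= kl a b.
Proof.
move=> a0 b0; have ba := divr_gt0 b0 a0.
have -> : kl a b = a * (b / a - 1 - ln (b / a)).
  rewrite /kl -[a / b]invf_div lnVN //.
  by move: (ln _) => t; field; rewrite gt_eqF.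
by rewrite mulr_ge0 ?(ltW a0) // subr_ge0 ln_le_sub1.
Qed.

(** This chi-square bound makes the divergence of second order in a small step, as the variational
    inequality requires. *)
Lemma kl_le a b : 0 < a -> 0 < b -> kl a b <= (a - b) ^+ 2 / b.
Proof.
move=> a0 b0; have -> : (a - b) ^+ 2 / b = a * (a / b - 1) - a + b.
  by field; rewrite gt_eqF.
by rewrite /kl lerD2r lerD2r ler_wpM2l ?(ltW a0) // ln_le_sub1 ?divr_gt0.
Qed.

Lemma kl_three a b c : 0 < a -> 0 < b -> 0 < c ->
  kl c b = kl c a + kl a b + (c - a) * ln (a / b).
Proof.
move=> a0 b0 c0; have -> : kl c b = c * (ln (c / a) + ln (a / b)) - c + b.
  rewrite /kl -lnM ?posrE ?divr_gt0 //; congr (c * ln _ - _ + _).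
  by field; rewrite !gt_eqF.
by rewrite /kl; ring.
Qed.

(** By convexity [kl _ b] lies above its tangent at [c], whose slope [ln (c / b)] is at most
    [ln ((1 + d) / d)] in absolute value. *)
Lemma kl_lip (d : R) a b c : 0 < d -> d <= a -> d <= b <= 1 + d ->
  d <= c <= 1 + d -> kl c b - kl a b <= `|c - a| * ln ((1 + d) / d).
Proof.
move=> d0 da /andP[db b1] /andP[dc c1].
have [a0 b0 c0] : [/\ 0 < a, 0 < b & 0 < c].
  by split; apply: lt_le_trans d0 _.
rewrite (kl_three c0 b0 a0); have := kl_ge0 a0 c0.
suff : (c - a) * ln (c / b) <= `|c - a| * ln ((1 + d) / d) by lra.
apply: le_trans (ler_norm _) _; rewrite normrM ler_wpM2l //.
have e0 : 0 < 1 + d by lra.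
rewrite ler_norml; apply/andP; split.
  rewrite -lnVN ?divr_gt0 // invf_div ler_ln ?posrE ?divr_gt0 //.
  rewrite ler_pdivlMr // mulrAC ler_pdivrMr //.
  by rewrite ler_pM // ltW.
rewrite ler_ln ?posrE ?divr_gt0 // ler_pdivlMr // mulrAC ler_pdivrMr //.
by rewrite ler_pM // ltW.
Qed.

(** Linearizing the logarithm at [b = 2 * a] and using [ln 2 <= 1] gives [kl a b >= b / 2 - a]. With
    [a = d] the divergence thus controls a coordinate that should vanish. *)
Lemma kl_lower a b : 0 < a -> 0 < b -> b - a <= 2 * kl a b + a.
Proof.
move=> a0 b0; rewrite /kl.
have -> : a / b = (b / (2 * a))^-1 * 2^-1 by field; rewrite !gt_eqF.
have t0 : 0 < b / (2 * a) by rewrite divr_gt0 // mulr_gt0.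
rewrite lnM ?posrE ?invr_gt0 // !lnVN //.
have h2 : ln (2 : R) <= 1 by have := @ln_le_sub1 2; lra.
have := ln_le_sub1 t0.
have : a * (b / (2 * a)) = b / 2 by field; rewrite gt_eqF.
move: (b / (2 * a)) => t; move: (ln t) (ln 2) h2 => lt l2 h2 e h; nra.
Qed.

End Kl.

Section Argmin.
Variables (R : realType) (J : finType).
Local Open Scope classical_set_scope.

(** Row vectors carry the topology in which the unit cube is compact. *)
Definition of_row (v : 'rV[R]_#|J|) (j : J) : R := v ord0 (enum_rank j).

Lemma continuous_of_row j : continuous (of_row^~ j).
Proof. exact: coord_continuous. Qed.

Lemma continuous_bigsum (X : topologicalType) (K : Type) (r : seq K)
  (P : pred K) (f : K -> X -> R) :
  (forall k, continuous (f k)) -> continuous (fun x => \sum_(k <- r | P k) f k x).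
Proof.
move=> fc; elim: r => [|k r IH] x.
  under eq_fun do rewrite big_nil; exact: cvg_cst.
under eq_fun do rewrite big_cons; case: (P k); last exact: IH.
by apply: continuousD; [exact: fc|exact: IH].
Qed.

(** The constraints cut a closed set out of the compact cube, so the continuous objective attains
    its minimum there. *)
Lemma compact_argmin (I : Type) (c : I -> (J -> R) -> R) (phi : J -> R -> R) :
  (forall i, continuous (c i \o of_row)) ->
  (forall j, continuous (phi j)) ->
  let A (x : J -> R) := (forall j, 0 <= x j <= 1) /\ (forall i, 0 <= c i x) in
  (exists x, A x) ->
  exists2 x, A x & forall y, A y -> \sum_j phi j (x j) <= \sum_j phi j (y j).
Proof.
move=> cc phic A [x0 Ax0].
pose row x : 'rV[R]_#|J| := \row_k x (enum_val k).
have rowK x : of_row (row x) = x.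
  by apply/funext => j; rewrite /of_row mxE enum_rankK.
pose B := [set v : 'rV[R]_#|J| | forall k, v ord0 k \in `[0, 1]%R].
have Bc : compact B.
  have := @rV_compact R #|J| (fun=> `[0, 1]%classic).
  by apply=> _; exact: segment_compact.
pose C := [set v : 'rV[R]_#|J| | A (of_row v)].
have CB : C `<=` B.
  move=> v [+ _] k => /(_ (enum_val k)).
  by rewrite /of_row enum_valK /= in_itv.
have Ccl : closed C.
  have -> : C = (\bigcap_j [set v | 0 <= of_row v j]) `&`
      (\bigcap_j [set v | of_row v j <= 1]) `&`
      (\bigcap_i [set v | 0 <= c i (of_row v)]).
    apply/seteqP; split=> v /=.
      move=> [h1 h2]; split; last by move=> i _; exact: h2.
      by split=> j _ /=; have /andP[] := h1 j.
    move=> [[h1 h2] h3]; split=> [j|i]; last exact: h3.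
    by rewrite h1 // h2.
  have closed_pre (f : 'rV[R]_#|J| -> R) (D : set R) :
      continuous f -> closed D -> closed (f @^-1` D).
    by move=> fc; apply: preimage_closed => v _; exact: fc.
  have closed_nneg (f : 'rV[R]_#|J| -> R) : continuous f ->
      closed [set v : 'rV[R]_#|J| | 0 <= f v].
    move=> fc; exact: (closed_pre f [set t | 0 <= t] fc (@closed_ge R 0)).
  apply: closedI; last first.
    by apply: closed_bigI => i _; exact: (closed_nneg _ (cc i)).
  apply: closedI; apply: closed_bigI => j _.
    by apply: closed_nneg; exact: continuous_of_row.
  apply: (closed_pre (of_row^~ j) [set t | t <= 1]); last exact: closed_le.
  exact: continuous_of_row.
have Cc : compact C by exact: subclosed_compact Bc CB.
have [|v|v] := @compact_EVT_min _ R (fun v => \sum_j phi j (of_row v j)) C _ Cc.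
- by exists (row x0); rewrite /C /= rowK.
- apply: continuous_subspaceT => w; apply: continuous_bigsum => j {}w.
  by apply: continuous_comp; [exact: continuous_of_row|exact: phic].
- rewrite inE => Cv vmin; exists (of_row v) => // y Ay.
  have := vmin (row y); rewrite rowK; apply.
  by rewrite inE /C /= rowK.
Qed.

Lemma continuous_klmax (w b d : R) : 0 < d -> 0 < b ->
  continuous (fun t : R => w * kl (Num.max t 0 + d) b).
Proof.
move=> d0 b0 t; rewrite /kl.
have t0 : 0 < Num.max t 0 + d by rewrite ltr_wpDl // le_max lexx orbT.
have ct : (Num.max s 0 + d : R^o) @[s --> t] --> (Num.max t 0 + d : R^o).
  apply: cvgD; last exact: cvg_cst.
  by apply: (@continuous_max _ _ (id : R -> R^o) (fun=> 0) t);
     [exact: cvg_id|exact: cvg_cst].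
have cl : ln ((Num.max s 0 + d) / b) @[s --> t] --> ln ((Num.max t 0 + d) / b).
  apply: continuous_cvg; first by apply: continuous_ln; rewrite divr_gt0.
  by apply: cvgM; [exact: ct|exact: cvg_cst].
apply: cvgM; first exact: cvg_cst.
apply: (@cvgD _ R^o); last exact: cvg_cst.
by apply: (@cvgB _ R^o) => //; apply: cvgM.
Qed.

End Argmin.

(** * The assignment polytope *)

Section Polytope.
Variables (R : realType) (T : rooted_tree) (m : nat).
Let J : finType := (node T * 'I_m)%type.
Implicit Types (x y z : J -> R) (p u v : node T) (S : {set J}) (s : nat).

(** Slots from [m] on count as entirely missing. *)
Definition slot x p s : R := if insub s is Some i then x (p, i) else 1.

Definition child_slots p S := [forall j in S, parent j.1 == Some p].

(** For [S] the set of all slots of the children this says that the children hold at most the mass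
    of [p], see [idle_ge0]. Smaller sets [S] make the constraint survive truncation at 1, see
    [polytope_truncate]. *)
Definition cover_ok x := forall p S, child_slots p S ->
  \sum_(s < #|S|) slot x p s <= \sum_(j in S) x j.

(* The assignment polytope of Bubeck, Cohen, Lee, Lee and Madry: [x (u, i)]
   is the missing fraction of the server number [i] below [u]. *)
Definition polytope x := [/\ forall j, 0 <= x j <= 1,
  forall i, x (Defs.root T, i) = 0 & cover_ok x].

Lemma polytope_ge0 x j : polytope x -> 0 <= x j.
Proof. by case=> /(_ j)/andP[]. Qed.

Lemma polytope_le1 x j : polytope x -> x j <= 1.
Proof. by case=> /(_ j)/andP[]. Qed.

Lemma slot_bounds x p s : (forall j, 0 <= x j <= 1) -> 0 <= slot x p s <= 1.
Proof. by rewrite /slot; case: insubP => // _; rewrite ler01 lexx. Qed.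

(** The constraint is applied to the coordinates of [S] that are at most 1; each other coordinate
    becomes 1, which pays for one more slot of [p]. *)
Lemma polytope_truncate x : (forall j, 0 <= x j) ->
  (forall i, x (Defs.root T, i) = 0) -> cover_ok x ->
  polytope (fun j => Num.min (x j) 1).
Proof.
move=> x0 xr xc; pose y j := Num.min (x j) 1.
have y01 j : 0 <= y j <= 1 by rewrite /y le_min x0 ler01 ge_min lexx orbT.
split=> // [i|p S Sp]; first by rewrite xr; apply/min_idPl.
pose S1 := [set j in S | x j <= 1].
have S1S : S1 \subset S by apply/fintype.subsetP => j; rewrite inE => /andP[].
have Sp1 : child_slots p S1.
  apply/forall_inP => j /(fintype.subsetP S1S) jS.
  exact: (forall_inP Sp).
have cS : #|S| = (#|S1| + #|S :\: S1|)%N.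
  by rewrite -(cardsID S1 S) (finset.setIidPr S1S).
rewrite (big_setID S1) /= (finset.setIidPr S1S) cS big_split_ord /=.
apply: lerD.
  have -> : \sum_(j in S1) Num.min (x j) 1 = \sum_(j in S1) x j.
    by apply: eq_bigr => j; rewrite inE => /andP[_ /min_idPl].
  apply: le_trans (xc p S1 Sp1); apply: ler_sum => s _.
  by rewrite /slot; case: insubP => // i _ _; rewrite ge_min lexx.
have -> : \sum_(j in S :\: S1) Num.min (x j) 1 = \sum_(j in S :\: S1) 1.
  apply: eq_bigr => j; rewrite !inE => /andP[+ jS]; rewrite jS /= -ltNge.
  by move=> /ltW/min_idPr.
apply: (le_trans (y := \sum_(s < #|S :\: S1|) 1)).
  by apply: ler_sum => s _; have /andP[] := slot_bounds p (#|S1| + s) y01.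
by rewrite !sumr_const card_ord.
Qed.

Lemma polytope_convex x y (t : R) : 0 <= t <= 1 -> polytope x -> polytope y ->
  polytope (fun j => (1 - t) * x j + t * y j).
Proof.
move=> /andP[t0 t1] [x01 xr xc] [y01 yr yc].
have t10 : 0 <= 1 - t by rewrite subr_ge0.
split=> [j|i|p S Sp].
- by have := x01 j; have := y01 j; nra.
- by rewrite xr yr !mulr0 addr0.
rewrite big_split -!mulr_sumr /=.
have -> : \sum_(s < #|S|) slot (fun j => (1 - t) * x j + t * y j) p s =
    (1 - t) * \sum_(s < #|S|) slot x p s + t * \sum_(s < #|S|) slot y p s.
  rewrite !mulr_sumr -big_split; apply: eq_bigr => s _ /=.
  by rewrite /slot; case: insubP => // _; ring.
by apply: lerD; apply: ler_wpM2l => //; [exact: xc|exact: yc].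
Qed.

(** [c] is closed under passing to children. If it meets the slots of [p], all coordinates in [S]
    are raised, and the right side grows by the factor [1 + e] and by [e * d] per slot, at least as
    much as the left. Otherwise only the right side grows. *)
Lemma cover_ok_raise x (c : J -> bool) (d e : R) :
  0 <= d -> 0 <= e -> polytope x ->
  (forall p i, c (p, i) -> forall u k, parent u = Some p -> c (u, k)) ->
  cover_ok (fun j => x j + e * ((c j)%:R * (x j + d))).
Proof.
move=> d0 e0 px cc p S Sp; have [x01 xr xc] := px.
case: (pickP (fun i => c (p, i))) => [i0 ci0|nc]; last first.
  apply: (le_trans (y := \sum_(j in S) x j)).
    apply: le_trans (xc p S Sp); apply: ler_sum => s _.
    by rewrite /slot; case: insubP => // i _ _; rewrite nc mul0r mulr0 addr0.
  apply: ler_sum => j _; rewrite lerDl !mulr_ge0 // addr_ge0 //.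
  by have /andP[] := x01 j.
have -> : \sum_(j in S) (x j + e * ((c j)%:R * (x j + d))) =
    (1 + e) * \sum_(j in S) x j + \sum_(j in S) (e * d).
  rewrite mulr_sumr -big_split; apply: eq_bigr => j /(forall_inP Sp)/eqP jp /=.
  by rewrite (surjective_pairing j) (cc _ _ ci0 _ _ jp) mul1r; ring.
apply: (le_trans (y := (1 + e) * \sum_(s < #|S|) slot x p s +
                         \sum_(s < #|S|) (e * d))); last first.
  rewrite !sumr_const card_ord lerD2r ler_wpM2l ?addr_ge0 //; exact: xc.
rewrite mulr_sumr -big_split; apply: ler_sum => s _ /=.
have ed : 0 <= e * d by rewrite mulr_ge0.
rewrite /slot; case: insubP => [i _ _|_]; last by nra.
have /andP[xi _] := x01 (p, i); have exi : 0 <= e * x (p, i) by rewrite mulr_ge0.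
by case: (c (p, i)); rewrite ?mul1r ?mul0r; nra.
Qed.

End Polytope.

(** * Projection *)

Section Projection.
Variables (R : realType) (T : rooted_tree) (m : nat).
Let J : finType := (node T * 'I_m)%type.
Variables (w : node T -> R) (d : R).
Hypothesis w_ge0 : forall v, 0 <= w v.
Hypothesis w_root : w (Defs.root T) = 0.
Hypothesis d_gt0 : 0 < d.
Hypothesis d_le1 : d <= 1.
Implicit Types (x y z : J -> R) (p u v : node T) (S : {set J}) (s : nat).

Definition divergence y x : R := \sum_j w j.1 * kl (y j + d) (x j + d).

(** The gradient of [divergence] in its first argument, taken at [x']. *)
Definition grad (x x' : J -> R) (j : J) : R := w j.1 * ln ((x' j + d) / (x j + d)).

Let shift_gt0 x j : polytope x -> 0 < x j + d.
Proof. by move=> px; rewrite ltr_wpDl // polytope_ge0. Qed.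

Lemma divergence_ge0 y x : polytope y -> polytope x -> 0 <= divergence y x.
Proof.
move=> py px; apply: sumr_ge0 => j _.
by rewrite mulr_ge0 // kl_ge0 ?shift_gt0.
Qed.

Lemma divergence_three (y x x' : J -> R) : polytope y -> polytope x -> polytope x' ->
  divergence y x = divergence y x' + divergence x' x +
    \sum_j grad x x' j * (y j - x' j).
Proof.
move=> py px px'; rewrite /divergence -!big_split; apply: eq_bigr => j _ /=.
rewrite /grad (@kl_three _ (x' j + d) (x j + d) (y j + d)) ?shift_gt0 //.
by ring.
Qed.

Lemma argmin_exists (x0 : J -> R) (l : node T) (i0 : 'I_m) : polytope x0 ->
  (exists2 y : J -> R, polytope y & y (l, i0) = 0) ->
  exists x' : J -> R, [/\ polytope x', x' (l, i0) <= d &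
    forall y : J -> R, polytope y -> y (l, i0) <= d ->
      divergence x' x0 <= divergence y x0].
Proof.
move=> px0 [y0 py0 y0l].
pose c (k : (node T * {set J}) + option 'I_m) x : R :=
  match k with
  | inl pS => if child_slots pS.1 pS.2
      then \sum_(j in pS.2) x j - \sum_(s < #|pS.2|) slot x pS.1 s else 0
  (* Together with the bounds of the cube this forces the root coordinates to be 0. *)
  | inr (Some i) => - x (Defs.root T, i)
  | inr None => d - x (l, i0)
  end.
(* The maximum with 0 keeps the logarithm continuous on the whole line; it changes nothing on the
   polytope. *)
pose phi (j : J) (t : R) := w j.1 * kl (Num.max t 0 + d) (x0 j + d).
have cst_cont (a : R) : continuous (fun _ : 'rV[R]_#|J| => a).
  by move=> v; exact: cst_continuous.
have cc k : continuous (c k \o @of_row R J).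
  case: k => [[p S]|[i|]] v.
  - rewrite /comp /c; case: (child_slots _ _); last exact: cst_cont.
    apply: continuousB; apply: continuous_bigsum => k; first exact: continuous_of_row.
    by rewrite /slot; case: insubP => [i _ _|_]; [exact: continuous_of_row|].
  - by apply: continuousN; exact: continuous_of_row.
  - by apply: continuousB; [exact: cst_cont|exact: continuous_of_row].
have phic j : continuous (phi j) by apply: continuous_klmax; rewrite ?shift_gt0.
have AE (x : J -> R) : (forall j, 0 <= x j <= 1) /\ (forall k, 0 <= c k x) <->
    polytope x /\ x (l, i0) <= d.
  split=> [[x01 cx]|[px xl]].
    split; last by have := cx (inr None); rewrite /= subr_ge0.
    split=> // [i|p S Sp].
      have := cx (inr (Some i)); rewrite /= oppr_ge0 => h.
      by apply/le_anti; rewrite h; have /andP[] := x01 (Defs.root T, i).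
    by have := cx (inl (p, S)); rewrite /= Sp subr_ge0.
  have [x01 xr xc] := px; split=> // -[[p S]|[i|]] /=.
  - by case: ifP => // Sp; rewrite subr_ge0; exact: xc.
  - by rewrite xr oppr0.
  - by rewrite subr_ge0.
have [|x' Ax' x'min] := @compact_argmin R J _ c phi cc phic.
  by exists y0; apply/AE; split=> //; rewrite y0l ltW.
have [px' x'l] := (AE x').1 Ax'; exists x'; split=> // y py yl.
have divE (x : J -> R) : polytope x -> \sum_j phi j (x j) = divergence x x0.
  move=> px; apply: eq_bigr => j _; rewrite /phi (max_idPl _) //.
  exact: polytope_ge0.
by rewrite -!divE //; apply: x'min; apply/AE.
Qed.

(* Along the segment from [x'] to [y] the divergence from [x0] has slope given
   by [grad] and a remainder quadratic in the step. *)
Lemma variational_inequality (x0 x' : J -> R) (l : node T) (i0 : 'I_m) :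
  polytope x0 -> polytope x' -> x' (l, i0) <= d ->
  (forall y : J -> R, polytope y -> y (l, i0) <= d ->
    divergence x' x0 <= divergence y x0) ->
  forall y : J -> R, polytope y -> y (l, i0) <= d ->
    0 <= \sum_j grad x0 x' j * (y j - x' j).
Proof.
move=> px0 px' x'l x'min y py yl; set s := \sum_j _.
pose C := \sum_j w j.1 * ((y j - x' j) ^+ 2 / (x' j + d)).
have C0 : 0 <= C.
  apply: sumr_ge0 => j _; rewrite mulr_ge0 // divr_ge0 ?sqr_ge0 // ltW //.
  exact: shift_gt0.
have slope e : 0 < e <= 1 -> 0 <= s + e * C.
  move=> /andP[e0 e1]; pose z j := (1 - e) * x' j + e * y j.
  have pz : polytope z by apply: polytope_convex => //; rewrite e1 ltW.
  have zl : z (l, i0) <= d by rewrite /z; nra.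
  have := x'min z pz zl; rewrite (divergence_three pz px0 px').
  have -> : \sum_j grad x0 x' j * (z j - x' j) = e * s.
    by rewrite /s mulr_sumr; apply: eq_bigr => j _; rewrite /z; ring.
  have : divergence z x' <= e * (e * C).
    rewrite /divergence /C !mulr_sumr; apply: ler_sum => j _.
    have -> : e * (e * (w j.1 * ((y j - x' j) ^+ 2 / (x' j + d)))) =
      w j.1 * ((z j + d - (x' j + d)) ^+ 2 / (x' j + d)).
      by rewrite /z; field; rewrite gt_eqF ?shift_gt0.
    by rewrite ler_wpM2l // kl_le ?shift_gt0.
  move=> h1 h2; have : 0 <= e * (s + e * C) by lra.
  by rewrite pmulr_rge0.
rewrite leNgt; apply/negP => s0.
have D0 : 0 < 1 + C - s by lra.
(* If [s < 0], this step size makes [s + e * C] equal to [s * (1 - s) / (1 + C - s) < 0], against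
   [slope]. *)
have e01 : 0 < - s / (1 + C - s) <= 1.
  by rewrite divr_gt0 ?oppr_gt0 // ler_pdivrMr // mul1r; lra.
have := slope _ e01.
have -> : s + - s / (1 + C - s) * C = s * (1 - s) / (1 + C - s).
  by field; rewrite gt_eqF.
by rewrite leNgt pmulr_llt0 ?invr_gt0 // pmulr_llt0 ?s0 //; lra.
Qed.

Section Step.
Variables (x0 x' y : J -> R) (l : node T) (i0 : 'I_m).
Hypotheses (px0 : polytope x0) (px' : polytope x') (py : polytope y).
Hypotheses (x'l : x' (l, i0) <= d) (yl : y (l, i0) = 0).
Hypothesis vi : forall z : J -> R, polytope z -> z (l, i0) <= d ->
  0 <= \sum_j grad x0 x' j * (z j - x' j).

Let g := grad x0 x'.
Let Q := \sum_j g j * (y j - x' j).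

(** A negative [g j] marks a decreased coordinate of positive weight. *)
Let raised u (j : J) := below j.1 u && ((j.1 != u) || (g j < 0)).

(** A child of a node below [u] is strictly below [u], so the raised set is closed under passing to
    children. *)
Let raise_feasible u (e : R) : u != Defs.root T -> 0 <= e ->
  polytope (fun j => Num.min (x' j + e * ((raised u j)%:R * (x' j + d))) 1).
Proof.
move=> ur e0; apply: polytope_truncate.
- move=> j; rewrite addr_ge0 ?(polytope_ge0 _ px') //.
  by rewrite !mulr_ge0 ?ler0n // ltW ?shift_gt0.
- move=> i; have [_ xr _] := px'; rewrite xr add0r.
  suff -> : raised u (Defs.root T, i) = false by rewrite mul0r mulr0.
  rewrite /raised /=; apply: contraNF ur => /andP[ru _].
  by apply/eqP; apply: below_anti ru; exact: below_root.
- apply: cover_ok_raise => //; first exact: ltW.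
  move=> p i /andP[/= pu _] v k vp; rewrite /raised /=.
  rewrite (below_trans (below_parent vp) pu) /=.
  by apply/orP; left; apply: contraTneq pu => <-; exact: parent_not_below.
Qed.

(** With this step size the truncation at 1 acts only on coordinates that are 1 already. The factor
    1/2 is due to [x' j + d <= 2]. *)
Let small_step : exists2 e : R, 0 < e &
  forall j, x' j < 1 -> x' j + e * (x' j + d) <= 1.
Proof.
pose F (j : J) := if x' j < 1 then (1 - x' j) / 2 else 1.
exists (\big[Num.min/1]_j F j).
  elim/big_ind: _ => // [a b a0 b0|j _]; first by rewrite lt_min a0.
  by rewrite /F; case: ifP => // h; rewrite divr_gt0 // subr_gt0.
move=> j xj; have xd2 : x' j + d <= 2 by have d1 := d_le1; lra.
set e : R := \big[_/_]_j _.
have : e <= F j by exact: bigmin_inf (lexx _).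
have e0 : 0 <= e.
  rewrite /e; elim/big_ind: _ => // [a b a0 b0|k _]; first by rewrite le_min a0.
  by rewrite /F; case: ifP => // h; rewrite divr_ge0 // subr_ge0 ltW.
have : e * (x' j + d) <= e * 2 by rewrite ler_wpM2l.
by rewrite /F xj; clearbody e; lra.
Qed.

(* When the raised point violates [x (l, i0) <= d], mixing it with [y] repairs
   this at the price of a multiple of [Q]. *)
Lemma raise_bound u : u != Defs.root T ->
  - (2 * Q * (below l u)%:R) <= \sum_j (raised u j)%:R * (g j * (x' j + d)).
Proof.
move=> ur; have [e e0 small] := small_step.
have pz := raise_feasible ur (ltW e0); set z := (fun j => _) in pz.
have xz : \sum_j g j * (z j - x' j) <=
    e * \sum_j (raised u j)%:R * (g j * (x' j + d)).
  rewrite mulr_sumr; apply: ler_sum => j _.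
  rewrite /z; set c := (raised u j)%:R.
  have c01 : 0 <= c <= 1 by rewrite /c; case: (raised u j); rewrite ?lexx ler01.
  have xd := shift_gt0 j px'.
  case: (leP (x' j + e * (c * (x' j + d))) 1) => [_|h]; first by nra.
  (* Where the truncation acts, [x' j] is maximal, hence [g j >= 0] and cutting off the increase is
     harmless. *)
  have x'1 : 1 <= x' j.
    rewrite leNgt; apply/negP => /small; apply/negP; rewrite -ltNge.
    apply: lt_le_trans h _; rewrite lerD2l ler_wpM2l ?(ltW e0) //.
    by rewrite ler_piMl ?(ltW xd) //; case/andP: c01.
  have gj : 0 <= g j.
    rewrite /g /grad mulr_ge0 // ln_ge0 // ler_pdivlMr ?shift_gt0 // mul1r.
    rewrite lerD2r; apply: le_trans x'1; exact: polytope_le1.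
  by nra.
rewrite -(ler_pM2l e0); apply: le_trans xz.
case: (boolP (below l u)) => lu; last first.
  rewrite mulr0 oppr0 mulr0; apply: vi => //.
  by rewrite /z /raised /= (negPf lu) /= mul0r mulr0 addr0 ge_min x'l.
rewrite mulr1.
(* Raising [x' (l, i0) <= d] gives at most [d * (1 + 2 * e)]. As [y] vanishes there, the weight
   [1 - t = 1 / (1 + 2 * e)] on [z] restores the bound [d]. *)
pose t := 2 * e / (1 + 2 * e).
have D0 : 0 < 1 + 2 * e by lra.
have t01 : 0 <= t <= 1.
  by rewrite /t divr_ge0 ?ler_pdivrMr //; lra.
have t1 : 1 - t = (1 + 2 * e)^-1 by rewrite /t; field; rewrite gt_eqF.
have := @vi _ (polytope_convex t01 pz py) _; rewrite /= yl mulr0 addr0.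
have zl : z (l, i0) <= d * (1 + 2 * e).
  rewrite /z ge_min; apply/orP; left.
  have ed : 0 <= e * d by rewrite mulr_ge0 // ltW.
  have xl := x'l; have : e * x' (l, i0) <= e * d by rewrite ler_wpM2l // ltW.
  by case: (raised u (l, i0)); rewrite ?mul1r ?mul0r ?mulr0; lra.
rewrite t1 mulrC ler_pdivrMr // => /(_ zl).
have -> : \sum_j grad x0 x' j * ((1 + 2 * e)^-1 * z j + t * y j - x' j) =
    (1 + 2 * e)^-1 * (\sum_j g j * (z j - x' j) + e * (2 * Q)).
  rewrite /Q !mulr_sumr -big_split mulr_sumr; apply: eq_bigr => j _ /=.
  by rewrite /t /g; field; rewrite gt_eqF.
by rewrite pmulr_rge0 ?invr_gt0 //; lra.
Qed.

(** When [raise_bound] is summed over [u], a non-root coordinate counts once for each strict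
    non-root ancestor and once more if it decreases. This bounds the total decrease, and an absolute
    value is the signed change plus twice the decrease. *)
Lemma movement_bound :
  \sum_j w j.1 * `|x' j - x0 j| <=
    4 * (height T)%:R * (divergence y x0 - divergence y x') +
    \sum_j (2 * (nranc j.1)%:R - 1) * (w j.1 * (x' j - x0 j)).
Proof.
set H : R := (height T)%:R.
have Q0 : 0 <= Q by apply: vi => //; rewrite yl ltW.
have gain : divergence y x0 - divergence y x' = divergence x' x0 + Q.
  by rewrite (divergence_three py px0 px') /Q /g; ring.
rewrite gain; pose k j := w j.1 * kl (x' j + d) (x0 j + d).
have k0 j : 0 <= k j by rewrite mulr_ge0 // kl_ge0 ?shift_gt0.
pose E j := g j * (x' j + d).
(* Testing the gradient against [x' + d] yields the signed change plus a divergence term, since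
   [a * ln (a / b) = (a - b) + kl a b]. *)
have EE j : E j = w j.1 * (x' j - x0 j) + k j.
  by rewrite /E /g /grad /k /kl; ring.
have raised_sum : \sum_(u | u != Defs.root T) \sum_j (raised u j)%:R * E j =
    \sum_j ((nranc j.1)%:R - 1 + (g j < 0)%R%:R) * E j.
  rewrite exchange_big; apply: eq_bigr => -[v i] _ /=.
  case: (eqVneq v (Defs.root T)) => [->|vr].
    have -> : E (Defs.root T, i) = 0 by rewrite /E /g /grad /= w_root !mul0r.
    by rewrite mulr0 big1 // => u _; rewrite mulr0.
  rewrite -mulr_suml; congr (_ * _).
  have -> : (nranc v)%:R - 1 =
      \sum_(u | (u != Defs.root T) && (u != v)) (below v u)%:R :> R.
    rewrite /nranc (bigD1 v) ?vr ?below_refl //= natrD addrAC subrr add0r natr_sum.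
    rewrite big_mkcond [RHS]big_mkcond; apply: eq_bigr => u _ /=.
    by case: (u == _); case: (u == v); case: (below v u).
  rewrite (bigD1 v) //= /raised /= below_refl eqxx /= addrC; congr (_ + _).
  apply: eq_bigr => u /andP[_ uv].
  by rewrite eq_sym uv andbT.
have lower : - (2 * Q * H) <= \sum_j ((nranc j.1)%:R - 1 + (g j < 0)%R%:R) * E j.
  rewrite -raised_sum; apply: (le_trans (y :=
    \sum_(u | u != Defs.root T) - (2 * Q * (below l u)%:R))); last first.
    by apply: ler_sum => u; exact: raise_bound.
  rewrite sumrN -mulr_sumr lerN2 ler_wpM2l ?mulr_ge0 //.
  rewrite -natr_sum ler_nat; apply: leq_trans (nranc_height l).
  by rewrite /nranc big_mkcondr /= leq_eqVlt; apply/orP; left;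
     apply/eqP; apply: eq_bigr => u _; case: (below l u).
have point j : w j.1 * `|x' j - x0 j| <= w j.1 * (x' j - x0 j) +
    2 * (k j - (g j < 0)%R%:R * E j).
  have [gj|gj] := ltP (g j) 0.
    rewrite mul1r EE; have : w j.1 * (x' j - x0 j) <= 0.
      have : E j <= 0 by rewrite /E nmulr_rle0 // ltW ?shift_gt0.
      by rewrite EE; have := k0 j; lra.
    move=> h; have -> : w j.1 * `|x' j - x0 j| = - (w j.1 * (x' j - x0 j)).
      by rewrite -(ger0_norm (w_ge0 j.1)) -normrM ler0_norm // ger0_norm.
    by lra.
  rewrite mul0r subr0; suff -> : w j.1 * `|x' j - x0 j| = w j.1 * (x' j - x0 j).
    by have := k0 j; lra.
  move: gj; rewrite /g /grad; have := w_ge0 j.1; rewrite le_eqVlt.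
  case/orP => [/eqP <-|wj]; first by rewrite !mul0r.
  rewrite pmulr_rge0 //; case: (ltP (x' j) (x0 j)) => h; last first.
    by rewrite ger0_norm ?subr_ge0.
  rewrite leNgt ln_lt0 // divr_gt0 ?shift_gt0 //=.
  by rewrite ltr_pdivrMr ?shift_gt0 // mul1r ltrD2r.
apply: (le_trans (ler_sum _ (fun j _ => point j))).
have kH : \sum_j (nranc j.1)%:R * k j <= H * divergence x' x0.
  rewrite /divergence mulr_sumr; apply: ler_sum => j _.
  by rewrite ler_wpM2r // ler_nat nranc_height.
have split1 : \sum_j (w j.1 * (x' j - x0 j) + 2 * (k j - (g j < 0)%R%:R * E j)) =
    \sum_j (2 * (nranc j.1)%:R - 1) * (w j.1 * (x' j - x0 j)) +
    2 * \sum_j (nranc j.1)%:R * k j -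
    2 * \sum_j ((nranc j.1)%:R - 1 + (g j < 0)%R%:R) * E j.
  rewrite !mulr_sumr -big_split -sumrB; apply: eq_bigr => j _ /=.
  by rewrite EE; ring.
(* The terms [2 * H * divergence x' x0] and [4 * Q * H] both fit into
   [4 * H * (divergence x' x0 + Q)]. *)
rewrite split1; have : 0 <= H * divergence x' x0.
  by rewrite mulr_ge0 ?ler0n // divergence_ge0.
by move: kH lower; lra.
Qed.

End Step.

(** The step is idle when the constraint already holds; [run_competitive] relies on this when the
    competitor never moves. *)
Lemma projection_exists (x0 : J -> R) (l : node T) (i0 : 'I_m) : polytope x0 ->
  (exists2 y : J -> R, polytope y & y (l, i0) = 0) ->
  exists x' : J -> R, [/\ polytope x', x' (l, i0) <= d,
    x0 (l, i0) <= d -> x' = x0 &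
    forall y : J -> R, polytope y -> y (l, i0) = 0 ->
    \sum_j w j.1 * `|x' j - x0 j| <=
      4 * (height T)%:R * (divergence y x0 - divergence y x') +
      \sum_j (2 * (nranc j.1)%:R - 1) * (w j.1 * (x' j - x0 j))].
Proof.
move=> px0 exy; case: (leP (x0 (l, i0)) d) => [x0l|_].
  exists x0; split=> // y py yl.
  rewrite big1 => [|j _]; last by rewrite subrr normr0 mulr0.
  by rewrite subrr mulr0 add0r big1 // => j _; rewrite subrr !mulr0.
have [x' [px' x'l x'min]] := argmin_exists px0 exy.
exists x'; split=> // y py yl.
apply: (@movement_bound _ _ _ l i0) => // z pz zl.
exact: (variational_inequality px0 px' x'l x'min).
Qed.

End Projection.

(** * Amortized analysis of a run *)

Section Run.
Variables (R : realType) (T : rooted_tree) (m : nat).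
Let J : finType := (node T * 'I_m)%type.
Variables (w : node T -> R) (d : R).
Hypothesis w_ge0 : forall v, 0 <= w v.
Hypothesis w_root : w (Defs.root T) = 0.
Hypothesis w_ge1 : forall v, v != Defs.root T -> 1 <= w v.
Hypothesis d_gt0 : 0 < d.
Variables (N : nat) (x y : nat -> J -> R) (q : nat -> node T) (i0 : 'I_m).
Hypothesis px : forall t, polytope (x t).
Hypothesis py : forall t, polytope (y t).
Hypothesis y01 : forall t j, y t j = 0 \/ y t j = 1.
Hypothesis xy0 : x 0%N = y 0%N.
Hypothesis y_serves : forall t, (t < N)%N -> y t.+1 (q t, i0) = 0.
Hypothesis x_lazy : forall t, (t < N)%N -> x t (q t, i0) <= d -> x t.+1 = x t.
Hypothesis x_step : forall t, (t < N)%N ->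
  forall z : J -> R, polytope z -> z (q t, i0) = 0 ->
    \sum_j w j.1 * `|x t.+1 j - x t j| <=
      4 * (height T)%:R * (divergence w d z (x t) - divergence w d z (x t.+1)) +
      \sum_j (2 * (nranc j.1)%:R - 1) * (w j.1 * (x t.+1 j - x t j)).

Let H : R := (height T)%:R.
Let L : R := ln ((1 + d) / d).

Definition opt_movement t : R := \sum_(s < t) \sum_j w j.1 * `|y s.+1 j - y s j|.
Definition movement t : R := \sum_(s < t) \sum_j w j.1 * `|x s.+1 j - x s j|.

Let H0 : 0 <= H. Proof. exact: ler0n. Qed.

Let L0 : 0 <= L.
Proof.
have d0 := d_gt0.
by apply: ln_ge0; rewrite ler_pdivlMr //; lra.
Qed.

Let term_ge0 (a b : R) (j : J) : 0 <= w j.1 * `|a - b|.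
Proof. by rewrite mulr_ge0. Qed.

Lemma opt_movement_ge0 t : 0 <= opt_movement t.
Proof. by apply: sumr_ge0 => s _; apply: sumr_ge0 => j _. Qed.

Lemma divergence_lip (z z' u : J -> R) : polytope z -> polytope z' ->
  polytope u -> divergence w d z' u - divergence w d z u <=
    L * \sum_j w j.1 * `|z' j - z j|.
Proof.
move=> pz pz' pu; rewrite /divergence -sumrB mulr_sumr; apply: ler_sum => j _.
rewrite -mulrBr mulrCA ler_wpM2l // [L * _]mulrC.
have -> : z' j - z j = (z' j + d) - (z j + d) by ring.
have d0 := d_gt0.
have := (polytope_ge0 j pz, polytope_ge0 j pz', polytope_ge0 j pu).
have := (polytope_le1 j pz, polytope_le1 j pz', polytope_le1 j pu).
by move=> [[? ?] ?] [[? ?] ?]; apply: kl_lip => //; lra.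
Qed.

(** The divergence of [y t] from [x t] is the potential: a move of [y] raises it by at most [L] per
    unit, and the drop caused by a move of [x] pays for that move. *)
Lemma movement_potential t : (t <= N)%N ->
  movement t <= 4 * H * (L * opt_movement t - divergence w d (y t) (x t)) +
    \sum_j (2 * (nranc j.1)%:R - 1) * (w j.1 * (x t j - x 0%N j)).
Proof.
elim: t => [_|t IH tN].
  rewrite /movement /opt_movement !big_ord0 mulr0 sub0r xy0 /divergence !big1 //.
  - by rewrite oppr0 mulr0 addr0.
  - by move=> j _; rewrite subrr !mulr0.
  - move=> j _; rewrite /kl divff ?ln1 ?mulr0 ?sub0r ?addNr ?mulr0 // gt_eqF //.
    by rewrite ltr_wpDl // polytope_ge0.
rewrite /movement /opt_movement !big_ord_recr /= -/(movement t) -/(opt_movement t).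
have := IH (ltnW tN); have := x_step tN (py t.+1) (y_serves tN).
have := divergence_lip (py t) (py t.+1) (px t).
set a := \sum_j _ * `|y _ j - _|; set b := \sum_j _ * `|x _ j - _|.
set D1 := divergence _ _ _ _; set D2 := divergence _ _ _ _.
set D3 := divergence _ _ _ _; set s1 := \sum_j _ => h1 h2 h3.
have -> : \sum_j (2 * (nranc j.1)%:R - 1) * (w j.1 * (x t.+1 j - x 0%N j)) =
    s1 + \sum_j (2 * (nranc j.1)%:R - 1) * (w j.1 * (x t j - x 0%N j)).
  by rewrite -big_split; apply: eq_bigr => j _ /=; ring.
have : 4 * H * (D1 - D2) <= 4 * H * (L * a) by rewrite ler_wpM2l // mulr_ge0.
by move: h2 h3; rewrite -/H !mulrBr !mulrDr; lra.
Qed.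

Let nranc_ge1 v : v != Defs.root T -> (1 <= nranc v)%N.
Proof. by move=> vr; rewrite /nranc (bigD1 v) // vr below_refl. Qed.

Let coef_le (v : node T) (a b : R) : a <= b -> 0 <= b ->
  (2 * (nranc v)%:R - 1) * (w v * a) <= 2 * H * (w v * b).
Proof.
move=> ab b0; case: (eqVneq v (Defs.root T)) => [->|vr].
  by rewrite w_root !mul0r !mulr0.
have n1 : 1 <= (nranc v)%:R :> R by rewrite ler1n nranc_ge1.
have nH : (nranc v)%:R <= H by rewrite ler_nat nranc_height.
have c0 : 0 <= 2 * (nranc v)%:R - 1 :> R by lra.
apply: (@le_trans _ _ ((2 * (nranc v)%:R - 1) * (w v * b))).
  by rewrite (ler_wpM2l c0) // ler_wpM2l.
by rewrite ler_wpM2r ?mulr_ge0 //; lra.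
Qed.

Lemma opt_movement_dist t :
  \sum_j w j.1 * `|y t j - y 0%N j| <= opt_movement t.
Proof.
elim: t => [|t IH].
  by rewrite /opt_movement big_ord0 big1 // => j _; rewrite subrr normr0 mulr0.
rewrite /opt_movement big_ord_recr /= -/(opt_movement t).
apply: le_trans (lerD IH (lexx _)); rewrite -big_split /=; apply: ler_sum => j _.
rewrite -mulrDr ler_wpM2l //.
have -> : y t.+1 j - y 0%N j = (y t j - y 0%N j) + (y t.+1 j - y t j) by ring.
exact: ler_normD.
Qed.

(** In the telescoped sum, [x N j] is at most [y N j] if the latter is 1, and is bounded by
    [kl_lower] if it is 0. The divergence that this produces, with factor [4 * H], cancels against
    the final potential. *)
Lemma movement_le : movement N <=
  (4 * H * L + 2 * H) * opt_movement N + 2 * H * (d * \sum_(j : J) w j.1).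
Proof.
apply: le_trans (movement_potential (leqnn N)) _.
have bound : \sum_j (2 * (nranc j.1)%:R - 1) * (w j.1 * (x N j - x 0%N j)) <=
    2 * H * (2 * divergence w d (y N) (x N) + d * \sum_(j : J) w j.1 +
             \sum_j w j.1 * `|y N j - y 0%N j|).
  rewrite xy0 /divergence !mulr_sumr -!big_split mulr_sumr /=.
  apply: ler_sum => j _.
  have d0 := d_gt0.
  have [xj0 xj1] := (polytope_ge0 j (px N), polytope_le1 j (px N)).
  have [yj0 yj1] := (polytope_ge0 j (py N), polytope_le1 j (py N)).
  have k0 : 0 <= kl (y N j + d) (x N j + d) by apply: kl_ge0; lra.
  have -> : 2 * (w j.1 * kl (y N j + d) (x N j + d)) + d * w j.1 +
      w j.1 * `|y N j - y 0%N j| =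
      w j.1 * (2 * kl (y N j + d) (x N j + d) + d + `|y N j - y 0%N j|) by ring.
  have a0 := normr_ge0 (y N j - y 0%N j).
  apply: coef_le; last by lra.
  have := ler_norm (y N j - y 0%N j).
  case: (y01 N j) => yE; last by lra.
  have := @kl_lower _ d (x N j + d) d0.
  by rewrite yE add0r in k0 *; lra.
apply: le_trans (lerD (lexx _) bound) _.
have : 2 * H * \sum_j w j.1 * `|y N j - y 0%N j| <= 2 * H * opt_movement N.
  by rewrite ler_wpM2l ?mulr_ge0 // opt_movement_dist.
by lra.
Qed.

(** Competitors are 0/1-valued, their root coordinates are constant and all other weights are at
    least 1. *)
Lemma opt_movement_dichotomy :
  1 <= opt_movement N \/ forall t, (t <= N)%N -> y t = y 0%N.
Proof.
case: (boolP [exists t : 'I_N, exists j : J, y t.+1 j != y t j]) => [|/existsPn h].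
  move=> /existsP[t /existsP[j jt]]; left.
  rewrite /opt_movement (bigD1 t) //= (bigD1 j) //= -addrA.
  apply: ler_wpDr.
    rewrite addr_ge0 ?sumr_ge0 // => s _; exact: sumr_ge0.
  have jr : j.1 != Defs.root T.
    apply: contraNneq jt => jr; rewrite (surjective_pairing j) jr.
    by have [_ -> _] := py t; have [_ -> _] := py t.+1.
  have -> : `|y t.+1 j - y t j| = 1.
    case: (y01 t j) (y01 t.+1 j) jt => -> [] ->; rewrite ?eqxx // => _.
      by rewrite subr0 normr1.
    by rewrite sub0r normrN1.
  by rewrite mulr1 w_ge1.
right; elim=> // t IH tN; rewrite -IH; last exact: ltnW.
apply/funext => j; apply/eqP.
by have /existsPn/(_ j) := h (Ordinal tN); rewrite negbK.
Qed.

(** If the competitor moves, its movement of at least 1 absorbs the additive error [2 * H].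
    Otherwise the common initial state already satisfies every request, and [x] stays there by
    laziness. *)
Lemma run_competitive : d * \sum_(j : J) w j.1 <= 1 ->
  movement N <= (4 * H * L + 4 * H) * opt_movement N.
Proof.
move=> dW; case: opt_movement_dichotomy => [M1|ycst].
  apply: le_trans movement_le _.
  have : 2 * H * (d * \sum_(j : J) w j.1) <= 2 * H * opt_movement N.
    by rewrite ler_wpM2l ?mulr_ge0 //; exact: le_trans M1.
  by lra.
have xcst t : (t <= N)%N -> x t = x 0%N.
  elim: t => // t IH tN; rewrite (x_lazy tN); first by rewrite IH // ltnW.
  by rewrite (IH (ltnW tN)) xy0 -(ycst _ tN) y_serves // ltW.
rewrite {1}/movement big1 ?mulr_ge0 ?addr_ge0 ?mulr_ge0 ?opt_movement_ge0 //.
move=> s _; apply: big1 => j _.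
by rewrite (xcst s.+1) // (xcst s) ?subrr ?normr0 ?mulr0 // ltnW.
Qed.

End Run.

(** * Competitors from integral solutions *)

(** If some [f i] is below its interval, that term is [a i - n] and the others are at most their
    [a i]. Otherwise no term exceeds its [f i]. *)
Lemma sum_clamp (I : finType) (P : pred I) (f a : I -> int) (n : int) :
  (forall i, 0 <= a i) -> \sum_(i | P i) a i <= n ->
  \sum_(i | P i) Num.min (Num.max (f i) (a i - n)) (a i) <=
  Num.min (Num.max (\sum_(i | P i) f i) (\sum_(i | P i) a i - n))
          (\sum_(i | P i) a i).
Proof.
move=> a0 an; have n0 : 0 <= n by apply: le_trans an; exact: sumr_ge0.
have up_a i : Num.min (Num.max (f i) (a i - n)) (a i) <= a i by lia.
rewrite le_min ler_sum // andbT le_max.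
case: (boolP [exists i, P i && (f i < a i - n)]) => [/existsP[i /andP[Pi fi]]|].
  apply/orP; right; rewrite (bigD1 i) //= [X in _ <= X - n](bigD1 i) //=.
  by rewrite addrAC lerD ?ler_sum //; lia.
move=> /existsPn h; apply/orP; left; apply: ler_sum => i Pi.
by have := h i; rewrite Pi -leNgt /= => fi; lia.
Qed.

Lemma sum_interval (m a b : nat) :
  (\sum_(i < m) ((a <= i) && (i < b)) <= b - a)%N.
Proof.
suff : (\sum_(i < m) ((a <= i) && (i < b)) <= minn m b - a)%N by lia.
elim: m => [|m IH]; first by rewrite big_ord0.
rewrite big_ord_recr /=; move: IH; set t := (\sum_(i < m) _)%N.
by case: (leqP a m) => ?; case: (ltnP m b) => ? /=; lia.
Qed.

Lemma sum_tail (m a : nat) : (\sum_(i < m) (a <= i) = m - a)%N.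
Proof.
elim: m => [|m IH]; first by rewrite big_ord0.
by rewrite big_ord_recr /= IH; case: (leqP a m) => ? /=; lia.
Qed.

Lemma Posz_sum (I : finType) (P : pred I) (f : I -> nat) :
  (\sum_(i | P i) f i)%N%:Z = \sum_(i | P i) (f i)%:Z.
Proof. exact: (big_morph Posz PoszD). Qed.

Section Counts.
Variables (R : realType) (T : rooted_tree) (k : nat) (s0 : 'I_k -> leaf T).
Implicit Types (c : 'I_k -> leaf T) (u v p : node T).

Definition subtotal (f : leaf T -> nat) u : nat :=
  \sum_(l : leaf T | below (val l) u) f l.

Definition servers c (l : leaf T) : nat := #|[set i | c i == l]|.

Definition active0 (l : leaf T) : nat := minn (servers s0 l) #|leaf T|.

(* With [n] leaves, no solution needs more than [n] servers from one initial
   leaf. Clamping the net flow into the subtree of [u] to an interval of length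
   [n] gives the counts of a solution that ignores the other servers and moves
   no more; this keeps [k] out of the competitive ratio. *)
Definition active c u : int :=
  (subtotal active0 u)%:Z +
  Num.min (Num.max ((subtotal (servers c) u)%:Z - (subtotal (servers s0) u)%:Z)
                   ((subtotal (fun=> 1%N) u)%:Z - #|leaf T|%:Z))
          (subtotal (fun=> 1%N) u)%:Z.

Lemma subtotal_children f p : ~~ is_leaf p ->
  subtotal f p = (\sum_(u | parent u == Some p) subtotal f u)%N.
Proof. exact: sum_below. Qed.

Lemma subtotal_leaf f (l : leaf T) : subtotal f (val l) = f l.
Proof.
rewrite /subtotal (big_pred1 l) // => l' /=.
apply/idP/eqP => [h|->]; last exact: below_refl.
by apply: val_inj; apply: below_leaf h; exact: valP.
Qed.

Lemma subtotal_root f : subtotal f (Defs.root T) = (\sum_l f l)%N.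
Proof. by apply: eq_bigl => l; rewrite below_root. Qed.

Lemma subtotal_servers c u : subtotal (servers c) u = #|[set i | below (val (c i)) u]|.
Proof.
rewrite /subtotal -sum1_card (partition_big c (fun l => below (val l) u)) /=.
  apply: eq_bigr => l lu; rewrite /servers -sum1_card; apply: eq_bigl => i.
  by rewrite !inE; case: eqP => [->|]; rewrite ?lu ?andbF.
by move=> i; rewrite inE.
Qed.

Lemma subtotal_card u : (subtotal (fun=> 1%N) u <= #|leaf T|)%N.
Proof. by rewrite /subtotal sum1_card max_card. Qed.

Lemma active_init u : active s0 u = (subtotal active0 u)%:Z.
Proof.
by rewrite /active subrr; have := subtotal_card u; lia.
Qed.

(** Either no initial leaf below [u] is capped, and the unclamped count is a number of servers, or a
    capped leaf contributes [#|leaf T|] servers, enough for the lower end of the clamping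
    interval. *)
Lemma active_ge0 c u : 0 <= active c u.
Proof.
rewrite /active; have n_le := subtotal_card u.
suff [h|h] : (subtotal active0 u = subtotal (servers s0) u)%N \/
    (#|leaf T| <= subtotal active0 u)%N by lia.
case: (boolP [forall l : leaf T,
  below (val l) u ==> (servers s0 l <= #|leaf T|)%N]) => [/forallP h|].
  left; apply: eq_bigr => l lu; apply/minn_idPl.
  by have /implyP/(_ lu) := h l.
rewrite negb_forall => /existsP[l]; rewrite negb_imply -ltnNge => /andP[lu sl].
right; rewrite /subtotal (bigD1 l) //=; apply: leq_trans (leq_addr _ _).
by rewrite /active0 (minn_idPr (ltnW sl)).
Qed.

Lemma active_root c : active c (Defs.root T) = (subtotal active0 (Defs.root T))%:Z.
Proof.
have -> : active c (Defs.root T) = active s0 (Defs.root T); last exact: active_init.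
rewrite /active !subtotal_servers.
have e c' : [set i | below (val (c' i)) (Defs.root T)] = [set: 'I_k].
  by apply/setP => i; rewrite !inE below_root.
by rewrite !e.
Qed.

(** The unclamped counts are additive over the children. Clamping may lose equality; the difference
    is mass that idles at [p]. *)
Lemma active_children c p : ~~ is_leaf p ->
  \sum_(u | parent u == Some p) active c u <= active c p.
Proof.
move=> np; have n_le := subtotal_card p.
rewrite /active !(subtotal_children _ np) !Posz_sum big_split -sumrB lerD2l /=.
by apply: sum_clamp => //; rewrite -Posz_sum -(subtotal_children _ np).
Qed.

Lemma active_parent c u p : parent u = Some p -> active c u <= active c p.
Proof.
move=> up_; have np : ~~ is_leaf p.
  by apply/forallPn; exists u; rewrite up_ eqxx.
apply: le_trans (active_children c np); rewrite (bigD1 u) ?up_ //= lerDl.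
by apply: sumr_ge0 => v _; exact: active_ge0.
Qed.

Lemma active_below c u v : below u v -> active c u <= active c v.
Proof.
move=> /belowP[j]; elim: j u => [u [->]//|j IH u].
case: (eqVneq u (Defs.root T)) => [->|/parent_exists[p up_]].
  by rewrite up_root.
by rewrite (upSr _ up_) => /IH; exact: le_trans (active_parent c up_).
Qed.

(** With [n] leaves, the interval at a leaf is from [1 - n] to 1: if the initial count is capped at
    [n], even the lower end leaves one server. *)
Lemma active_served c (i : 'I_k) : 1 <= active c (val (c i)).
Proof.
have n1 : (0 < #|leaf T|)%N by apply/card_gt0P; exists (c i).
have s1 : (0 < servers c (c i))%N.
  by apply/card_gt0P; exists i; rewrite inE.
by rewrite /active !subtotal_leaf /active0; lia.
Qed.

Lemma subtotal_servers_sum c u :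
  subtotal (servers c) u = (\sum_i below (val (c i)) u)%N.
Proof.
rewrite subtotal_servers -sum1_card big_mkcond; apply: eq_bigr => i _.
by rewrite inE; case: below.
Qed.

Definition crossings c c' u : nat :=
  \sum_i (below (val (c i)) u != below (val (c' i)) u).

(** Clamping to a fixed interval is 1-Lipschitz. *)
Lemma active_move c c' u :
  (absz (active c' u - active c u)%R <= crossings c c' u)%N.
Proof.
have h (e e' : 'I_k -> leaf T) :
    (subtotal (servers e') u <= subtotal (servers e) u + crossings e e' u)%N.
  rewrite !subtotal_servers_sum -big_split; apply: leq_sum => i _ /=.
  by case: below; case: below.
have h1 := h c c'; have h2 := h c' c.
have e : crossings c' c u = crossings c c' u.
  by apply: eq_bigr => i _; rewrite eq_sym.
rewrite e in h2; have := subtotal_card u.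
move: h1 h2; rewrite /active; move: (crossings _ _ _) => X; lia.
Qed.

(** The number of servers that take part, at most the square of the number of leaves whatever [k]
    is. *)
Definition nslots : nat := \sum_l active0 l.

Definition competitor c (j : node T * 'I_nslots) : R :=
  (`|active c j.1| <= j.2)%N%:R.

Let absz_active c u : `|active c u|%N = active c u :> int.
Proof. by rewrite gez0_abs // active_ge0. Qed.

Lemma active_nslots c u : (`|active c u| <= nslots)%N.
Proof.
rewrite -lez_nat absz_active /nslots -subtotal_root -(active_root c).
exact: active_below (below_root u).
Qed.

Lemma competitor01 c j : competitor c j = 0 \/ competitor c j = 1.
Proof. by rewrite /competitor; case: leqP; [right|left]. Qed.

(** By [active_children] at most [active c p] slots in [S] are filled, while the first [#|S|] slots
    of [p] miss exactly the excess of [#|S|] over [active c p]. *)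
Lemma competitor_polytope c : polytope (competitor c).
Proof.
split=> [j|i|p S Sp].
- by case: (competitor01 c j) => ->; rewrite ?lexx ler01.
- rewrite /competitor /= active_root subtotal_root -/nslots absz_nat.
  by rewrite leqNgt ltn_ord.
have -> : \sum_(s < #|S|) slot (competitor c) p s =
    \sum_(s < #|S|) (`|active c p| <= s)%N%:R.
  apply: eq_bigr => s _; rewrite /slot; case: insubP => [i _ <-//|].
  by rewrite -leqNgt => h; rewrite (leq_trans (active_nslots c p) h).
rewrite -!natr_sum ler_nat sum_tail leq_subLR.
case: (pickP [in S]) => [j0 j0S|S0]; last by rewrite eq_card0.
have np : ~~ is_leaf p by apply/forallPn; exists j0.1; rewrite negbK (forall_inP Sp).
have -> : #|S| = (\sum_(j in S) (j.2 < `|active c j.1|) +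
                 \sum_(j in S) (`|active c j.1| <= j.2))%N.
  by rewrite -sum1_card -big_split; apply: eq_bigr => j _ /=; case: leqP.
rewrite leq_add2r; apply: (@leq_trans
  (\sum_(u | parent u == Some p) `|active c u|)); last first.
  rewrite -lez_nat absz_active Posz_sum.
  by under eq_bigr do rewrite absz_active; exact: active_children.
apply: (@leq_trans (\sum_(u | parent u == Some p) \sum_(i < nslots)
   (i < `|active c u|)%N)); last first.
  apply: leq_sum => u _.
  by have := sum_interval nslots 0 `|active c u|; rewrite subn0.
rewrite pair_big_dep /= [leqLHS]big_mkcond [leqRHS]big_mkcond /=.
apply: leq_sum => j _; case: ifP => // jS.
by rewrite (forall_inP Sp).
Qed.

Lemma competitor_served c (i : 'I_k) (i0 : 'I_nslots) : i0 = 0%N :> nat ->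
  competitor c (val (c i), i0) = 0.
Proof.
move=> e; rewrite /competitor /= e leqn0 absz_eq0 gt_eqF //.
exact: active_served.
Qed.

(** The slots of [u] that change are those between the two counts. *)
Lemma competitor_move c c' (w : node T -> R) : (forall v, 0 <= w v) ->
  \sum_j w j.1 * `|competitor c' j - competitor c j| <=
  \sum_u w u * (crossings c c' u)%:R.
Proof.
move=> w0; rewrite (eq_bigr (fun j => (fun u i =>
  w u * `|competitor c' (u, i) - competitor c (u, i)|) j.1 j.2)); last by case.
rewrite -(pair_bigA _ (fun u i =>
  w u * `|competitor c' (u, i) - competitor c (u, i)|)) /=.
apply: ler_sum => u _; rewrite -mulr_sumr ler_wpM2l //.
set a := `|active c u|%N; set a' := `|active c' u|%N.
apply: (@le_trans _ _ (\sum_(i < nslots) (((a <= i) && (i < a')) +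
  ((a' <= i) && (i < a)))%N%:R)).
  apply: ler_sum => i _; rewrite /competitor /= -/a -/a'.
  by case: leqP => ?; case: leqP => ?; rewrite ?subrr ?subr0 ?sub0r ?normrN ?normr0 ?normr1.
rewrite -natr_sum ler_nat big_split /=.
apply: leq_trans (leq_add (sum_interval _ _ _) (sum_interval _ _ _)) _.
have := active_move c c' u.
rewrite -[active c' u]absz_active -[active c u]absz_active -/a -/a'.
by move: (crossings _ _ _) a a' => X a a'; lia.
Qed.

End Counts.

(** * Server mass at the leaves *)

Section Mass.
Variables (R : realType) (T : rooted_tree) (m : nat) (lambda : R).
Hypothesis lambda_ge2 : 2 <= lambda.
Let J : finType := (node T * 'I_m)%type.
Variables (frozen : leaf T -> R) (phi : node T -> leaf T).
Hypothesis frozen_ge0 : forall l, 0 <= frozen l.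
Hypothesis phi_leaf : forall l : leaf T, phi (val l) = l.
Hypothesis phi_parent : forall s p, parent s = Some p ->
  sep lambda (val (phi s)) (val (phi p)) <= 4 * wt lambda s.
Implicit Types (x : J -> R) (u v p s : node T) (l : leaf T).

Definition mass x v : R := \sum_i (1 - x (v, i)).

Definition idle x v : R := mass x v - \sum_(u | parent u == Some v) mass x u.

(** Converts a point of the polytope into a leaf configuration; [frozen] stands for the servers
    beyond the cap in [active0], which never move. *)
Definition leaf_mass x l : R := frozen l + \sum_(v | phi v == l) idle x v.

Lemma idle_leaf x l : idle x (val l) = mass x (val l).
Proof.
rewrite /idle big_pred0 ?subr0 // => u.
by have /forallP/(_ u)/negPf := valP l.
Qed.

Lemma mass_ge0 x v : polytope x -> 0 <= mass x v.
Proof. by move=> px; apply: sumr_ge0 => i _; rewrite subr_ge0 polytope_le1. Qed.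

Lemma slot_sum x v (n : nat) : (m <= n)%N ->
  \sum_(s < n) slot x v s = \sum_i x (v, i) + (n - m)%:R.
Proof.
move=> /subnKC <-; rewrite big_split_ord addKn /=; congr (_ + _).
  apply: eq_bigr => i _; rewrite /slot insubT //= => h.
  by congr (x (v, _)); apply: val_inj.
rewrite (eq_bigr (fun=> 1)) ?sumr_const ?card_ord // => i _.
by rewrite /slot insubF // ltnNge leq_addr.
Qed.

(** The covering constraint for all slots of the children: one child already has [m] slots, so all
    slots of [v] are used and each further one counts as 1. *)
Lemma idle_ge0 x v : polytope x -> 0 <= idle x v.
Proof.
move=> px; case: (boolP (is_leaf v)) => [lv|/nonleaf_child[u0 u0v]].
  by rewrite -[v]/(val (Sub v lv : leaf T)) idle_leaf mass_ge0.
pose S : {set J} := [set j | parent j.1 == Some v].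
have Sv : child_slots v S by apply/forall_inP => j; rewrite inE.
have mS : (m <= #|S|)%N.
  rewrite -[leqLHS]card_ord -(card_imset _ (f := fun i : 'I_m => (u0, i) : J)).
    by apply: subset_leq_card; apply/fintype.subsetP => j /imsetP[i _ ->]; rewrite inE u0v.
  by move=> i i' [].
rewrite /idle.
have -> : \sum_(u | parent u == Some v) mass x u = \sum_(j in S) (1 - x j).
  rewrite /mass pair_big_dep /=; apply: eq_big => [[u i]|[u i] _] //=.
  by rewrite inE andbT.
have [_ _ /(_ v S Sv)] := px.
rewrite sumrB sumr_const /mass sumrB sumr_const card_ord.
rewrite (slot_sum _ _ mS) natrB //; lra.
Qed.

Lemma leaf_mass_ge0 x l : polytope x -> 0 <= leaf_mass x l.
Proof.
by move=> px; rewrite addr_ge0 // sumr_ge0 // => v _; exact: idle_ge0.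
Qed.

Lemma leaf_mass_ge x l i0 : polytope x -> 1 - x (val l, i0) <= leaf_mass x l.
Proof.
move=> px; rewrite /leaf_mass (bigD1 (val l)) ?phi_leaf //= idle_leaf.
rewrite /mass (bigD1 i0) //=.
have h1 : 0 <= \sum_(i < m | i != i0) (1 - x (val l, i)).
  by apply: sumr_ge0 => i _; rewrite subr_ge0 polytope_le1.
have h2 : 0 <= \sum_(v | (phi v == l) && (v != val l)) idle x v.
  by apply: sumr_ge0 => v _; exact: idle_ge0.
by have := frozen_ge0 l; lra.
Qed.

Let phi_up s := if parent s is Some p then phi p else phi s.

(** Summation by parts: the mass of [s] counts positively at the anchor of [s] and negatively at
    that of its parent. *)
Lemma leaf_mass_below x x' u : polytope x -> polytope x' ->
  \sum_(l | below (val l) u) (leaf_mass x l - leaf_mass x' l) =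
  \sum_s ((below (val (phi s)) u)%:R - (below (val (phi_up s)) u)%:R) *
    (mass x s - mass x' s).
Proof.
move=> px px'.
have -> : \sum_(l | below (val l) u) (leaf_mass x l - leaf_mass x' l) =
    \sum_v (below (val (phi v)) u)%:R * (idle x v - idle x' v).
  rewrite [RHS](bigID (fun v => below (val (phi v)) u)) /= [X in _ + X]big1 ?addr0.
    rewrite (partition_big phi (fun l => below (val l) u)) //=.
    apply: eq_bigr => l lu; rewrite /leaf_mass opprD addrACA subrr add0r -sumrB.
    rewrite big_mkcond [RHS]big_mkcond; apply: eq_bigr => v _.
    by case: eqP => [->|_]; rewrite ?lu ?andbF //= mul1r.
  by move=> v /negPf ->; rewrite mul0r.
have idleB v : idle x v - idle x' v = (mass x v - mass x' v) -
    \sum_(s | parent s == Some v) (mass x s - mass x' s).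
  by rewrite /idle sumrB; ring.
under eq_bigr => v _ do rewrite idleB mulrBr.
rewrite sumrB.
have -> : \sum_v (below (val (phi v)) u)%:R *
      \sum_(s | parent s == Some v) (mass x s - mass x' s) =
    \sum_s (s != Defs.root T)%:R * (below (val (phi_up s)) u)%:R *
      (mass x s - mass x' s).
  under eq_bigr => v _ do rewrite mulr_sumr big_mkcond.
  rewrite exchange_big; apply: eq_bigr => s _ /=.
  case: (eqVneq s (Defs.root T)) => [->|/parent_exists[p sp]].
    by rewrite !mul0r big1 // => v _; rewrite parent_root.
  rewrite -big_mkcond (big_pred1 p) /phi_up ?sp ?mul1r //.
rewrite -sumrB; apply: eq_bigr => s _.
case: (eqVneq s (Defs.root T)) => [->|_]; last by rewrite mul1r -mulrBl.
(* The mass of the root is constant, so the root contributes nothing. *)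
have mr z : polytope z -> mass z (Defs.root T) = m%:R.
  case=> _ zr _; rewrite /mass (eq_bigr (fun=> 1)) => [|i _]; last by rewrite zr subr0.
  by rewrite sumr_const card_ord.
by rewrite !mr // subrr !mulr0 subrr.
Qed.

(** A change of mass at [s] amounts to transport between the anchors of [s] and of its parent, which
    are at distance at most [4 * wt lambda s]. *)
Lemma leaf_mass_transport x x' : polytope x -> polytope x' ->
  \sum_u wt lambda u *
    `|\sum_(l | below (val l) u) (leaf_mass x l - leaf_mass x' l)| <=
  4 * \sum_j wt lambda j.1 * `|x' j - x j|.
Proof.
move=> px px'; have w0 := @wt_ge0 R T lambda lambda_ge2.
apply: (@le_trans _ _ (\sum_s sep lambda (val (phi s)) (val (phi_up s)) *
    `|mass x s - mass x' s|)).
  rewrite /sep; under [leRHS]eq_bigr => s _ do rewrite mulr_suml.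
  rewrite exchange_big; apply: ler_sum => u _ /=.
  under [leRHS]eq_bigr => s _ do rewrite -mulrA.
  rewrite -mulr_sumr ler_wpM2l // leaf_mass_below //.
  apply: le_trans (ler_norm_sum _ _ _) _; apply: ler_sum => s _.
  rewrite normrM ler_wpM2r //.
  by case: below; case: below; rewrite ?subrr ?subr0 ?sub0r ?normrN ?normr0 ?normr1.
rewrite mulr_sumr (eq_bigr (fun j : J => (fun s i =>
  4 * (wt lambda s * `|x' (s, i) - x (s, i)|)) j.1 j.2)); last by case.
rewrite -(pair_bigA _ (fun s i => 4 * (wt lambda s * `|x' (s, i) - x (s, i)|))) /=.
apply: ler_sum => s _; rewrite -!mulr_sumr mulrA.
have h1 : sep lambda (val (phi s)) (val (phi_up s)) <= 4 * wt lambda s.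
  rewrite /phi_up; case E: (parent s) => [p|]; first exact: phi_parent.
  by rewrite sepxx mulr_ge0.
apply: ler_pM => //; first exact: sep_ge0.
have -> : mass x s - mass x' s = \sum_i (x' (s, i) - x (s, i)).
  by rewrite /mass -sumrB; apply: eq_bigr => i _; ring.
exact: ler_norm_sum.
Qed.

Lemma leaf_mass_total x x' : polytope x -> polytope x' ->
  \sum_l (leaf_mass x l - leaf_mass x' l) = 0.
Proof.
move=> px px'; rewrite (eq_bigl (fun l => below (val l) (Defs.root T))).
  rewrite leaf_mass_below // big1 // => s _.
  by rewrite !below_root subrr mul0r.
by move=> l; rewrite below_root.
Qed.

End Mass.

(** No clamping takes place in the initial state, so the counts are additive and internal nodes have
    no idle mass. *)
Lemma leaf_mass_init (R : realType) (T : rooted_tree) (k : nat)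
    (s0 : 'I_k -> leaf T) (phi : node T -> leaf T) (l : leaf T) :
  (forall l : leaf T, phi (val l) = l) ->
  leaf_mass (fun l => (servers s0 l - active0 s0 l)%:R) phi
    (@competitor R T k s0 s0) l = initial_mass R s0 l.
Proof.
move=> phi_leaf; rewrite /leaf_mass.
have massE u : mass (@competitor R T k s0 s0) u = (subtotal (active0 s0) u)%:R.
  rewrite /mass /competitor /= active_init absz_nat.
  have nu : (subtotal (active0 s0) u <= nslots s0)%N.
    by rewrite -[leqLHS]/(`|(subtotal (active0 s0) u)%:Z|)%N -active_init active_nslots.
  by rewrite sumrB sumr_const card_ord -natr_sum sum_tail natrB // subKr.
have idle0 v : ~~ is_leaf v -> idle (@competitor R T k s0 s0) v = 0.
  move=> nv; rewrite /idle massE subtotal_children // natr_sum.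
  by rewrite -sumrB big1 // => u _; rewrite massE subrr.
rewrite (bigD1 (val l)) ?phi_leaf //= idle_leaf massE subtotal_leaf.
rewrite big1 => [|v /andP[/eqP vl lv]].
  by rewrite addr0 -natrD subnK // geq_minl.
case: (boolP (is_leaf v)) => [iv|]; last exact: idle0.
have e : v = val (Sub v iv : leaf T) by [].
by rewrite e phi_leaf in vl; rewrite e vl eqxx in lv.
Qed.

(** * The algorithm *)

Definition no_moves (R : realType) (T : rooted_tree) : moves R T := fun _ _ => 0.

Lemma apply_no_moves (R : realType) (T : rooted_tree) (z : config R T) :
  apply_moves z (@no_moves R T) = z.
Proof.
by apply/funext => v; rewrite /apply_moves !big1 // subr0 addr0.
Qed.

Lemma foldl_no_moves (R : realType) (T : rooted_tree) (z : config R T) (r : seq nat) :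
  foldl (@apply_moves R T) z [seq @no_moves R T | _ <- r] = z.
Proof. by elim: r => //= i r IH; rewrite apply_no_moves. Qed.

Lemma moves_cost0 (R : realType) (T : rooted_tree) (lambda : R) :
  moves_cost lambda (@no_moves R T) = 0.
Proof. by apply: big1 => u _; apply: big1 => v _; rewrite mul0r. Qed.

Lemma nsteps_gt0 (R : realType) (eta : R) : 0 < eta -> (0 < nsteps eta)%N.
Proof. by move=> e0; rewrite nstepsP // mul0r. Qed.

Lemma onth_take (X : Type) (s : seq X) (j : nat) (r : X) : onth s j = Some r ->
  (j < size s)%N /\ take j.+1 s = rcons (take j s) r.
Proof.
elim: s j => [|a s IH] [|j] //=; first by case=> ->; rewrite take0.
by move=> /IH[js ->].
Qed.

Lemma ltn_onth (X : Type) (s : seq X) (j : nat) : (j < size s)%N ->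
  exists r, onth s j = Some r.
Proof. by elim: s j => [|a s IH] [|j] //= h; [exists a|exact: IH]. Qed.

Section Algorithm.
Variables (R : realType) (T : rooted_tree) (lambda : R) (k : nat).
Variables (s0 : 'I_k -> leaf T) (d : R).
Let m := nslots s0.
Let w := @wt R T lambda.
Hypothesis k_gt0 : (0 < k)%N.
Hypothesis lambda_ge2 : 2 <= lambda.
Hypothesis d_gt0 : 0 < d.
Hypothesis d_le1 : d <= 1.
Hypothesis d_small : d * \sum_(j : node T * 'I_m) w j.1 <= 1.

Let w_ge0 v : 0 <= w v. Proof. exact: wt_ge0. Qed.
Let w_root : w (Defs.root T) = 0. Proof. by rewrite /w /wt eqxx. Qed.

Let m_gt0 : (0 < m)%N.
Proof.
rewrite /m /nslots (bigD1 (s0 (Ordinal k_gt0))) //= addn_gt0 /active0.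
rewrite leq_min; apply/orP; left; apply/andP; split.
  by apply/card_gt0P; exists (Ordinal k_gt0); rewrite inE.
by apply/card_gt0P; exists (s0 (Ordinal k_gt0)).
Qed.

Let i0 : 'I_m := Ordinal m_gt0.

(** At the first timestep after a request the state is projected and the leaf mass transported
    accordingly; the other timesteps are idle. The outer factor 4 comes from
    [leaf_mass_transport]. *)
Lemma algorithm_exists : exists A : online_algorithm R T,
  forall (eta : R) (s : seq (request T)), 0 < eta ->
  [/\ valid_run eta (initial_mass R s0) A s,
      forall delta : R, d < delta ->
        serves eta (initial_mass R s0) A delta s &
      forall S, feasible s0 s S -> run_cost eta A lambda s <=
        4 * ((4 * (height T)%:R * ln ((1 + d) / d) + 4 * (height T)%:R) *
             solution_cost lambda s S)].
Proof.
have [phi [phi_leaf phi_parent]] := @anchor_exists R T lambda lambda_ge2.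
pose step_ok (x : node T * 'I_m -> R) (l : leaf T) (x' : node T * 'I_m -> R) :=
  polytope x -> [/\ polytope x', x' (val l, i0) <= d,
    x (val l, i0) <= d -> x' = x &
    forall y, polytope y -> y (val l, i0) = 0 ->
    \sum_j w j.1 * `|x' j - x j| <= 4 * (height T)%:R *
      (divergence w d y x - divergence w d y x') +
      \sum_j (2 * (nranc j.1)%:R - 1) * (w j.1 * (x' j - x j))].
(* As a function of the state and the requested leaf only, the projection makes [state] depend on
   past requests alone, hence the algorithm online. *)
have /choice[proj projP] xl : exists x', step_ok xl.1 xl.2 x'.
  case: xl => x l.
  case: (pselect (polytope x)) => [px|npx]; last by exists x.
  have [|x' hx'] := projection_exists w_ge0 w_root d_gt0 d_le1 (l := val l) (i0 := i0) px.
    (* All servers at [l]: a competitor that satisfies the request. *)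
    exists (@competitor R T k s0 (fun=> l)); first exact: competitor_polytope.
    exact: (@competitor_served R T k s0 (fun=> l) (Ordinal k_gt0) i0 erefl).
  by exists x'.
have /choice[G GP] (f : leaf T -> R) : exists g : leaf T -> leaf T -> R,
    \sum_l f l = 0 ->
    [/\ forall a b, 0 <= g a b, forall a, \sum_b g a b = Num.max (f a) 0,
     forall b, \sum_a g a b = Num.max (- f b) 0 &
     \sum_a \sum_b g a b * sep lambda (val a) (val b) <=
      \sum_u wt lambda u * `|\sum_(l : leaf T | below (val l) u) f l|].
  case: (pselect (\sum_l f l = 0)) => [f0|nf0]; last by exists (@no_moves R T).
  by have [g gP] := transport lambda_ge2 f0; exists g.
pose state (h : seq (request T)) := foldl (fun x (r : request T) => proj (x, r.1))
  (@competitor R T k s0 s0) h.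
have pstate h : polytope (state h).
  elim/last_ind: h => [|h r IH]; first exact: competitor_polytope.
  by rewrite /state foldl_rcons; have [] := projP (state h, r.1) IH.
pose frozen l : R := (servers s0 l - active0 s0 l)%:R.
pose M h := leaf_mass frozen phi (state h).
have M0 : M [::] = initial_mass R s0.
  by apply/funext => l; exact: leaf_mass_init.
pose prev (h : seq (request T)) := take (size h).-1 h.
pose A : online_algorithm R T := fun h i =>
  if i is 0%N then G (fun l => M (prev h) l - M h l) else @no_moves R T.
have frozen0 l : 0 <= frozen l by exact: ler0n.
have balanced h : \sum_l (M (prev h) l - M h l) = 0 by exact: leaf_mass_total.
have A0 h : apply_moves (M (prev h)) (A h 0%N) = M h.
  apply/funext => l; have [_ grow gcol _] := GP _ (balanced h).
  rewrite /apply_moves grow gcol /=; move: (M (prev h) l) (M h l) => a b.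
  by case: (leP (a - b) 0) => ab; [rewrite max_l|rewrite max_r]; lra.
have steps h i : after_steps A h (M (prev h)) i.+1 = M h.
  rewrite /after_steps /= A0 -[RHS](foldl_no_moves (M h) (iota 1 i)).
  by rewrite (iotaDl 1 0) -!map_comp.
have prev_take (s : seq (request T)) j : (j < size s)%N ->
    prev (take j.+1 s) = take j s.
  by move=> js; rewrite /prev size_takel //= take_takel.
have startE eta (s : seq (request T)) j : 0 < eta -> (j <= size s)%N ->
    start_config eta (initial_mass R s0) A s j = M (take j s).
  move=> e0; elim: j => [_|j IH js]; first by rewrite /= take0 M0.
  rewrite /= (IH (ltnW js)) -(prev_take _ _ js).
  by rewrite -(prednK (nsteps_gt0 e0)) steps.
exists A => eta s e0; split.
- move=> j i js _; rewrite startE ?(ltnW js) // -(prev_take _ _ js).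
  set h := take j.+1 s; case: i => [|i].
    have [g0 grow _ _] := GP _ (balanced h).
    split=> [u v|u]; first exact: g0.
    rewrite /= grow ge_max /after_steps /= lerBlDr lerDl.
    by rewrite !leaf_mass_ge0.
  rewrite steps /=; split=> [u v|u]; first exact: lexx.
  by rewrite big1 // leaf_mass_ge0.
- move=> delta ddelta j r jr; have [js sj] := onth_take jr.
  exists 0%N; first exact: nsteps_gt0.
  rewrite /mass_at startE ?(ltnW js) // -(prev_take _ _ js) steps.
  have := projP (state (take j s), r.1) (pstate _) => /= -[px xl _ _].
  rewrite sj /M /state foldl_rcons -/(state (take j s)).
  have := leaf_mass_ge frozen0 phi_leaf r.1 i0 px.
  by lra.
- move=> S [S0 Sserves].
  pose x t := state (take t s); pose y t := @competitor R T k s0 (S t).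
  pose q t : node T := if onth s t is Some r then val r.1 else Defs.root T.
  have cost_step (j : 'I_(size s)) :
      \sum_(i < nsteps eta) moves_cost lambda (A (take j.+1 s) i) <=
      4 * \sum_i w i.1 * `|x j.+1 i - x j i|.
    rewrite -(prednK (nsteps_gt0 e0)) big_ord_recl big1 ?addr0; last first.
      by move=> i _; exact: moves_cost0.
    have [_ _ _ gcost] := GP _ (balanced (take j.+1 s)).
    rewrite /moves_cost /=.
    under eq_bigr => u _ do under eq_bigr => v _ do rewrite hst_distE //.
    apply: le_trans gcost _; rewrite prev_take //.
    exact: leaf_mass_transport.
  have runE : run_cost eta A lambda s <= 4 * movement w x (size s).
    by rewrite /run_cost /movement mulr_sumr; apply: ler_sum => j _; exact: cost_step.
  apply: le_trans runE _; rewrite ler_wpM2l //.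
  (* Exchanging sums turns the distances travelled by the servers into weighted numbers of
     crossings. *)
  have optE : opt_movement w y (size s) <= solution_cost lambda s S.
    rewrite /opt_movement /solution_cost; apply: ler_sum => t _.
    apply: le_trans (@competitor_move R T k s0 (S t) (S t.+1) w w_ge0) _.
    under [leRHS]eq_bigr => i _ do rewrite hst_distE //.
    rewrite /sep exchange_big; apply: ler_sum => u _ /=.
    by rewrite -mulr_sumr natr_sum.
  have L0 : 0 <= ln ((1 + d) / d).
    by have d0 := d_gt0; apply: ln_ge0; rewrite ler_pdivlMr //; lra.
  apply: (@le_trans _ _ ((4 * (height T)%:R * ln ((1 + d) / d) +
     4 * (height T)%:R) * opt_movement w y (size s))); last first.
    by rewrite ler_wpM2l // addr_ge0 // ?mulr_ge0.
  have xstep t : (t < size s)%N -> exists r, [/\ onth s t = Some r, q t = val r.1 &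
      step_ok (x t) r.1 (x t.+1)].
    move=> ts; have [r tr] := ltn_onth ts; exists r; split=> //.
      by rewrite /q tr.
    have [_ sj] := onth_take tr.
    rewrite /x sj /state foldl_rcons -/(state (take t s)).
    exact: (projP (state (take t s), r.1)).
  apply: (@run_competitive R T m w d w_ge0 w_root _ d_gt0 (size s) x y q i0) => //.
  + by move=> v; exact: wt_ge1.
  + by move=> t; exact: pstate.
  + by move=> t; exact: competitor_polytope.
  + by move=> t j; exact: competitor01.
  + by rewrite /x take0 /y S0.
  + move=> t ts; have [r [tr -> _]] := xstep t ts.
    have [i <-] := Sserves _ _ tr.
    exact: (@competitor_served R T k s0 (S t.+1) i i0 erefl).
  + move=> t ts; have [r [tr -> ok]] := xstep t ts.
    by have [] := ok (pstate _).
  + move=> t ts z pz; have [r [tr -> ok]] := xstep t ts.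
    by have [_ _ _ h] := ok (pstate _); exact: h.
Qed.

End Algorithm.

(** * Choice of the shift and the competitive ratio *)

Lemma sum_wt_le (R : realType) (T : rooted_tree) (lambda : R) :
  1 <= lambda -> (0 < height T)%N -> (height T)%:R <= lambda ->
  \sum_v @wt R T lambda v <= #|leaf T|%:R * lambda ^+ height T.
Proof.
move=> l1 H0 Hl; have l0 : 0 <= lambda by exact: le_trans l1.
have w0 v : 0 <= @wt R T lambda v.
  by rewrite /wt; case: ifP => // _; rewrite exprn_ge0.
(* Each node is charged to the leaves below it. A leaf has at most [height T <= lambda] non-root
   ancestors, each of weight at most [lambda ^+ (height T).-1]. *)
apply: (@le_trans _ _ (\sum_v \sum_(l : leaf T | below (val l) v)
    @wt R T lambda v)).
  apply: ler_sum => v _; have [l lv] := leaf_below v.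
  by rewrite (bigD1 l) //= lerDl sumr_ge0.
rewrite (exchange_big_dep xpredT) //= mulr_natl -sumr_const.
apply: ler_sum => l _.
rewrite (bigID (fun v => v == Defs.root T)) /= big1 ?add0r => [|v]; last first.
  by case/andP=> _ /eqP ->; rewrite /wt eqxx.
apply: (@le_trans _ _ (\sum_(v | (v != Defs.root T) && below (val l) v)
    lambda ^+ (height T).-1)).
  rewrite (eq_bigl _ _ (fun v => andbC _ _)); apply: ler_sum => v /andP[vr _].
  rewrite /wt (negPf vr) ler_weXn2l // -ltnS prednK //.
  exact: level_lt_height.
rewrite sumr_const -sum1_card -/(nranc (val l)) -mulr_natl -[in leRHS](prednK H0) exprS.
rewrite ler_wpM2r ?exprn_ge0 //.
by apply: le_trans Hl; rewrite ler_nat nranc_height.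
Qed.

Lemma nslots_le (T : rooted_tree) (k : nat) (s0 : 'I_k -> leaf T) :
  (nslots s0 <= #|leaf T| * #|leaf T|)%N.
Proof.
rewrite /nslots -sum_nat_const; apply: leq_sum => l _.
exact: geq_minr.
Qed.

(** The left side is at most [3 + 3 * ln n + H * ln lambda], and [ln lambda >= 9 / 10] lets
    [4 * H * ln lambda] absorb the constant 3. *)
Lemma log_bound (R : realType) (n lambda d : R) (H : nat) :
  1 <= n -> 10 <= lambda -> (0 < H)%N ->
  d = (2 * n ^+ 3 * lambda ^+ H)^-1 ->
  ln ((1 + d) / d) + 1 <= 5 * H%:R * ln (n * lambda).
Proof.
move=> n1 l10 H0 dE; have n0 : 0 < n by lra.
have l0 : 0 < lambda by lra.
have H1 : 1 <= H%:R :> R by rewrite ler1n.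
set X := n ^+ 3 * lambda ^+ H.
have X1 : 1 <= X.
  by rewrite /X mulr_ege1 ?exprn_ege1 //; lra.
have ddE : (1 + d) / d = 1 + 2 * X.
  by rewrite dE -mulrA -/X; field; rewrite gt_eqF //; lra.
have lnX : ln X = 3 * ln n + H%:R * ln lambda.
  rewrite /X lnM ?posrE ?exprn_gt0 // !lnXn //.
  by rewrite -[_ *+ 3]mulr_natl -[_ *+ H]mulr_natl.
have ln3X : ln (1 + 2 * X) <= 2 + ln X.
  apply: (@le_trans _ _ (ln (3 * X))).
    by rewrite ler_ln ?posrE; lra.
  rewrite lnM ?posrE; [|lra|lra].
  by have := @ln_le_sub1 R 3; lra.
have ln_lambda : 9 / 10 <= ln lambda.
  have : ln lambda^-1 <= lambda^-1 - 1 by rewrite ln_le_sub1 ?invr_gt0.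
  have : lambda^-1 <= 10^-1 by rewrite lef_pV2 ?posrE //; lra.
  by rewrite lnVN //; lra.
have ln_n : 0 <= ln n by rewrite ln_ge0.
have hn : ln n <= H%:R * ln n by rewrite ler_peMl.
have hl : ln lambda <= H%:R * ln lambda by rewrite ler_peMl //; lra.
by rewrite ddE lnM ?posrE //; lra.
Qed.

Lemma feasible_exists (T : rooted_tree) (k : nat) (s0 : 'I_k -> leaf T)
  (s : seq (request T)) : (0 < k)%N -> exists S, feasible s0 s S.
Proof.
move=> k0; exists (fun j i => if j is j'.+1 then
  if onth s j' is Some r then r.1 else s0 i else s0 i).
by split=> // j r ->; exists (Ordinal k0).
Qed.

Lemma height0_leaf (T : rooted_tree) (l l' : leaf T) : height T = 0%N -> l = l'.
Proof.
move=> H0; have r (x : leaf T) : val x = Defs.root T.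
  apply/eqP; apply: contraT => /level_lt_height.
  by rewrite H0 ltn0.
by apply: val_inj; rewrite !r.
Qed.

Theorem theorem5p3 (R : realType) :
  exists2 C : R, 0 < C &
  forall (T : rooted_tree) (lambda : R) (k : nat) (s0 : 'I_k -> leaf T),
    let n : R := #|leaf T|%:R in
    let H : R := (height T)%:R in
    let delta' : R := 1 / n ^+ 2 in
    (0 < k)%N ->
    H <= lambda / 10 ->
    exists2 eta0 : R, 0 < eta0 <= 1 &
    forall eta : R, 0 < eta < eta0 ->
    exists A : online_algorithm R T,
    forall s : seq (request T), increasing_times s ->
      [/\ valid_run eta (initial_mass R s0) A s,
          serves eta (initial_mass R s0) A delta' s &
          run_cost eta A lambda s
            <= C * (H ^+ 2 * ln (n * lambda)) * opt_cost lambda s0 s].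
Proof.
(* 80 is 16 times 5: the run costs at most [16 * H * (L + 1)] times a solution, with
   [L = ln ((1 + d) / d)], and [log_bound] bounds [L + 1]. *)
exists 80 => // T lambda k s0 n H delta' k0 Hl.
(* All movement happens at the first timestep, so any [eta] below 1 will do. *)
exists 1; first by rewrite ltr01 lexx.
move=> eta /andP[eta0 _]; pose l0 := s0 (Ordinal k0).
have n_gt0 : (0 < #|leaf T|)%N by apply/card_gt0P; exists l0.
(* At height 0 the cost bound is 0; there is a single leaf, it holds all servers, and nothing has to
   move. *)
case: (posnP (height T)) => [H0|H0].
  exists (fun _ _ => @no_moves R T) => s _.
  have stepsE h z i : after_steps (fun _ _ => @no_moves R T) h z i = z.
    exact: foldl_no_moves.
  have startE j :
      start_config eta (initial_mass R s0) (fun _ _ => @no_moves R T) s j =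
      initial_mass R s0.
    by elim: j => //= j ->; rewrite stepsE.
  split.
  - move=> j i _ _; rewrite startE stepsE; split=> // u.
    by rewrite big1 // ler0n.
  - move=> j r _; exists 0%N; first exact: nsteps_gt0.
    rewrite /mass_at startE stepsE /initial_mass.
    have -> : [set i | s0 i == r.1] = [set: 'I_k].
      by apply/setP => i; rewrite !inE (height0_leaf (s0 i) r.1 H0) eqxx.
    have n1 : #|leaf T| = 1%N.
      by apply: (@eq_card1 _ l0) => l; rewrite [RHS]inE (height0_leaf l l0 H0) inE eqxx.
    by rewrite /delta' /n n1 expr1n divr1 subrr cardsT card_ord ltr0n.
  - rewrite /H H0 expr0n mul0r mulr0 mul0r /run_cost big1 // => j _.
    by apply: big1 => i _; exact: moves_cost0.
have H1 : 1 <= H by rewrite ler1n.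
have n1 : 1 <= n by rewrite ler1n.
have l10 : 10 <= lambda by lra.
have l1 : 1 <= lambda by lra.
have lH1 : 1 <= lambda ^+ height T by rewrite exprn_ege1.
(* The total weight over all nodes and slots is at most [n ^+ 2 * (n * lambda ^+ height T)]; the
   factor 2 makes [d < delta'] strict. *)
pose d : R := (2 * n ^+ 3 * lambda ^+ height T)^-1.
have n31 : 1 <= n ^+ 3 by rewrite exprn_ege1.
have D0 : 0 < 2 * n ^+ 3 * lambda ^+ height T by rewrite !mulr_gt0 //; lra.
have d0 : 0 < d by rewrite invr_gt0.
have D2 : 2 <= 2 * n ^+ 3 * lambda ^+ height T.
  by rewrite -mulrA ler_peMr // mulr_ege1.
have d1 : d <= 1 by rewrite invf_le1 //; lra.
have ddelta : d < delta'.
  rewrite /delta' div1r ltf_pV2 ?posrE ?exprn_gt0 //; last by lra.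
  apply: (@lt_le_trans _ _ (2 * n ^+ 3)); last by rewrite ler_peMr //; lra.
  rewrite exprS mulrA; have : 1 <= n ^+ 2 by rewrite exprn_ege1.
  by nra.
have dW : d * \sum_(j : node T * 'I_(nslots s0)) @wt R T lambda j.1 <= 1.
  rewrite mulrC ler_pdivrMr // mul1r.
  have -> : \sum_(j : node T * 'I_(nslots s0)) @wt R T lambda j.1 =
      (nslots s0)%:R * \sum_v @wt R T lambda v.
    rewrite -(pair_bigA _ (fun v (_ : 'I_(nslots s0)) => @wt R T lambda v)) /=.
    rewrite mulr_sumr; apply: eq_bigr => v _.
    by rewrite sumr_const card_ord mulr_natl.
  have w0 : 0 <= \sum_v @wt R T lambda v.
    by apply: sumr_ge0 => v _; apply: wt_ge0; lra.
  apply: (@le_trans _ _ (n ^+ 2 * (n * lambda ^+ height T))).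
    apply: ler_pM => //.
      by rewrite expr2 -natrM ler_nat nslots_le.
    by apply: sum_wt_le => //; rewrite -/H; lra.
  rewrite mulrA -exprSr -mulrA ler_peMl ?ler1n //.
  by rewrite mulr_ge0 //; lra.
have [|A AP] := @algorithm_exists R T lambda k s0 d k0 _ d0 d1 dW; first by lra.
exists A => s _; have [val_run srv cost] := AP eta s eta0.
split=> //; first exact: srv.
have [S0 feas0] := feasible_exists s0 s k0.
set c := 80 * _.
have c0 : 0 < c.
  have ln_pos : 0 < ln (n * lambda).
    by apply: ln_gt0; apply: (@lt_le_trans _ _ lambda); [lra|rewrite ler_peMl //; lra].
  apply: mulr_gt0; first by lra.
  by apply: mulr_gt0 => //; apply: exprn_gt0; lra.
have costc S : feasible s0 s S -> run_cost eta A lambda s <= c * solution_cost lambda s S.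
  move=> fS; apply: le_trans (cost S fS) _; rewrite mulrA ler_wpM2r //.
    apply: sumr_ge0 => j _; apply: sumr_ge0 => i _; rewrite hst_distE; last by lra.
    by apply: sep_ge0; lra.
  have := log_bound n1 l10 H0 (erefl d); rewrite -/H /c.
  move: (ln _) (ln (n * lambda)) => L1 L2 h.
  have : 16 * H * (L1 + 1) <= 16 * H * (5 * H * L2) by rewrite ler_wpM2l //; lra.
  by rewrite expr2; lra.
(* Divided by [c > 0], the run cost is a lower bound for every solution cost, hence for the
   infimum. *)
rewrite -ler_pdivrMl // /opt_cost; apply: lb_le_inf.
  by exists (solution_cost lambda s S0); exists S0.
move=> _ [S fS ->]; rewrite ler_pdivrMl //; exact: costc.
Qed.
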